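(* Let $3\le n\le\infty$ and let $\Gamma\le\mathrm{Sym}(n)$. Suppose that the permutation group $\Gamma$ of $[n]$ is neither generously transitive nor semi-generous. Then the Schur multiplier $\mathrm{H}_2(\mathcal{K}(\Gamma),\mathbf{Z})$ of the (abstract) kaleidoscopic group $\mathcal{K}(\Gamma)$ is non-trivial; indeed it is not a torsion group.
   Context: A dendrite is a locally connected continuum (non-empty compact connected metrizable space) containing no simple closed curve. Any two distinct points $x,y$ of a dendrite $X$ are joined by a unique arc $[x,y]$; put $(x,y)=[x,y]\setminus\{x,y\}$. For $x\in X$, $\widehat{x}=\pi_0(X\setminus\{x\})$ is the (at most countable) set of components of $X\setminus\{x\}$; $x$ is a branch point if $|\widehat{x}|\ge 3$, and $\mathrm{Br}(X)$ is the (at most countable) set of branch points. For $3\le n\le\infty$ ($\infty$ meaning countably infinite), the Ważewski dendrite $D_n$ is the dendrite, unique up to homeomorphism, which is not a single point, in which $|\widehat{x}|=n$ for every branch point $x$, and in which $(x,y)$ contains a branch point for all $x\ne y$. Write $[n]=\{m\in\mathbf{N}: m<n\}$ (so $[\infty]=\mathbf{N}\ni 0$) and $\mathrm{Sym}(n)$ for the group of all permutations of $[n]$. A coloring of $D_n$ is a map $c$ from $\widehat{D_n}=\bigsqcup_{x\in\mathrm{Br}(D_n)}\widehat{x}$ to $[n]$ whose restriction $c_x=c|_{\widehat{x}}$ is a bijection $\widehat{x}\to[n]$ for each $x\in \mathrm{Br}(D_n)$; for $y\ne x$, $c_x(y)$ denotes the color of the component of $D_n\setminus\{x\}$ containing $y$.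 The coloring is kaleidoscopic if for all distinct $x,y\in\mathrm{Br}(D_n)$ and all distinct $i,j\in[n]$ there is $z\in(x,y)\cap\mathrm{Br}(D_n)$ with $c_z(x)=i$ and $c_z(y)=j$. For $g\in\mathrm{Homeo}(D_n)$ and $x\in\mathrm{Br}(D_n)$ put $\sigma_c(g,x)=c_{g(x)}\circ g\circ c_x^{-1}\in\mathrm{Sym}(n)$, where $g$ is viewed as a bijection $\widehat{x}\to\widehat{g(x)}$. For $\Gamma\le\mathrm{Sym}(n)$ put $\mathcal{K}_c(\Gamma)=\{g\in\mathrm{Homeo}(D_n):\sigma_c(g,x)\in\Gamma\ \text{for all } x\in\mathrm{Br}(D_n)\}$. Kaleidoscopic colorings exist and for any two of them, $c$ and $d$, the groups $\mathcal{K}_c(\Gamma)$ and $\mathcal{K}_d(\Gamma)$ are conjugate in $\mathrm{Homeo}(D_n)$; $\mathcal{K}(\Gamma)$ denotes $\mathcal{K}_c(\Gamma)$ for some (any) kaleidoscopic coloring $c$. An action of a group $G$ on a set is generously transitive if for any $x,y$ in the set there is $g\in G$ with $g(x)=y$ and $g(y)=x$. Two actions of the same group are orthogonal if the diagonal action on the product is transitive. An action is semi-generous if the set decomposes into exactly two orbits, these two orbits are orthogonal, and the action on each of them is generously transitive. *)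

(* Defs.v *)
(* Predicates that are not decidable are turned into booleans classically, by
   `[< _ >], so that the library's subgroup and quotient structures apply. *)
From HB Require Import structures.
From mathcomp Require Import all_boot all_order all_algebra.
From mathcomp Require Import freeg.
From mathcomp Require Import all_classical all_reals topology.

Set Implicit Arguments.
Unset Strict Implicit.
Unset Printing Implicit Defensive.

Import Order.TTheory GRing.Theory Num.Theory.
Import numFieldTopology.Exports.

Local Open Scope classical_set_scope.
Local Open Scope card_scope.
Local Open Scope ring_scope.

Section SecondHomology.
Variable G : groupType.

(* The bar complex of G tensored with the trivial module Z: the basis element
   << (g, h) >> is [g|h] and << (g, h, k) >> is [g|h|k]. *)
Definition bar_d2 : {freeg (G * G)%type / int} -> {freeg G / int} :=
  fglift (fun u : G * G => << u.2 >> - << (u.1 * u.2)%g >> + << u.1 >>).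

Definition bar_d3 :
    {freeg (G * G * G)%type / int} -> {freeg (G * G)%type / int} :=
  fglift (fun u : G * G * G =>
    << (u.1.2, u.2) >> - << ((u.1.1 * u.1.2)%g, u.2) >>
    + << (u.1.1, (u.1.2 * u.2)%g) >> - << (u.1.1, u.1.2) >>).

Definition cycle2_pred : {pred {freeg (G * G)%type / int}} :=
  fun z => bar_d2 z == 0.

Lemma cycle2_zmod_closed : zmod_closed cycle2_pred.
Proof.
have dB : {morph bar_d2 : x y / x - y} by exact: lift_is_additive.
split; first by rewrite unfold_in -(subrr 0) dB subrr.
by move=> x y /eqP hx /eqP hy; rewrite unfold_in dB hx hy subrr.
Qed.

HB.instance Definition _ :=
  GRing.isZmodClosed.Build _ cycle2_pred cycle2_zmod_closed.

Definition cycle2 : Type := {z : {freeg (G * G)%type / int} | z \in cycle2_pred}.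

HB.instance Definition _ := SubChoice.on cycle2.
HB.instance Definition _ := [SubChoice_isSubZmodule of cycle2 by <:].

Definition boundary2 : {pred cycle2} :=
  fun z => `[< exists w, bar_d3 w = val z >].

Lemma boundary2_zmod_closed : zmod_closed boundary2.
Proof.
have dB : {morph bar_d3 : x y / x - y} by exact: lift_is_additive.
split; first by apply/asboolP; exists 0; rewrite -(subrr 0) dB subrr raddf0.
move=> x y /asboolP[w hw] /asboolP[v hv]; apply/asboolP; exists (w - v).
by rewrite dB hw hv raddfB.
Qed.

HB.instance Definition _ :=
  GRing.isZmodClosed.Build _ boundary2 boundary2_zmod_closed.

Definition H2 : zmodType := Quotient.quot boundary2.

End SecondHomology.

Definition trivial_group (A : zmodType) : Prop := forall a : A, a = 0.

Definition torsion_group (A : zmodType) : Prop :=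
  forall a : A, exists2 k : nat, (0 < k)%N & a *+ k = 0.

Section SymmetricGroup.
Variable T : choiceType.

(* (g * h)%g is g \o h. *)
Record SymGroup : Type :=
  MkSym { sym_fun :> T -> T; sym_bij : `[< bijective sym_fun >] }.

HB.instance Definition _ := [isSub for sym_fun].
HB.instance Definition _ := [Choice of SymGroup by <:].

Lemma symP (g : SymGroup) : bijective g.
Proof. by apply/asboolP; exact: sym_bij. Qed.

Lemma sym_eqP (g h : SymGroup) : g =1 h -> g = h.
Proof. by move=> gh; apply: val_inj; apply/funext. Qed.

Definition sym_one : SymGroup :=
  MkSym (asboolT (@Bijective T T id id (fun=> erefl) (fun=> erefl))).

Definition sym_mul (g h : SymGroup) : SymGroup :=
  MkSym (asboolT (bij_comp (symP g) (symP h))).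

Lemma sym_inv_subproof (g : SymGroup) :
  exists h : SymGroup, cancel g h /\ cancel h g.
Proof.
case: (symP g) => h gh hg.
have hb : bijective h by exists g.
by exists (MkSym (asboolT hb)).
Qed.

Definition sym_inv (g : SymGroup) : SymGroup := projT1 (cid (sym_inv_subproof g)).

Lemma symK (g : SymGroup) : cancel g (sym_inv g).
Proof. by rewrite /sym_inv; case: cid => h []. Qed.

Lemma symVK (g : SymGroup) : cancel (sym_inv g) g.
Proof. by rewrite /sym_inv; case: cid => h []. Qed.

Lemma sym_mulA : associative sym_mul.
Proof. by move=> f g h; apply: sym_eqP. Qed.
Lemma sym_mul1 : left_id sym_one sym_mul.
Proof. by move=> f; apply: sym_eqP. Qed.
Lemma sym_mulr1 : right_id sym_one sym_mul.
Proof. by move=> f; apply: sym_eqP. Qed.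
Lemma sym_mulV : left_inverse sym_one sym_inv sym_mul.
Proof. by move=> f; apply: sym_eqP => x /=; rewrite symK. Qed.
Lemma sym_mulrV : right_inverse sym_one sym_inv sym_mul.
Proof. by move=> f; apply: sym_eqP => x /=; rewrite symVK. Qed.

HB.instance Definition _ :=
  isGroup.Build SymGroup sym_mulA sym_mul1 sym_mulr1 sym_mulV sym_mulrV.

(* A subgroup of the group of permutations of T, acting on T. *)
Variable Gamma : groupClosed SymGroup.

Definition orbit_of (x : T) : set T :=
  [set y | exists2 g, g \in Gamma & g x = y].

Definition generously_transitive_on (A : set T) : Prop :=
  forall x y, A x -> A y ->
    exists2 g, g \in Gamma & g x = y /\ g y = x.

(* Transitivity of the diagonal action on A * B. *)
Definition orthogonal_on (A B : set T) : Prop :=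
  forall a b a' b', A a -> B b -> A a' -> B b' ->
    exists2 g, g \in Gamma & g a = a' /\ g b = b'.

Definition generously_transitive : Prop := generously_transitive_on setT.

Definition semi_generous : Prop :=
  exists a b : T,
    [/\ orbit_of a <> orbit_of b,
        forall x, orbit_of x = orbit_of a \/ orbit_of x = orbit_of b,
        orthogonal_on (orbit_of a) (orbit_of b),
        generously_transitive_on (orbit_of a)
      & generously_transitive_on (orbit_of b)].

End SymmetricGroup.

Definition homeomorphism (X Y : topologicalType) (f : X -> Y) : Prop :=
  exists g : Y -> X,
    [/\ cancel f g, cancel g f, continuous f & continuous g].

Section Dendrites.
Variables (R : realType) (X : topologicalType).

Definition metrizable : Prop :=
  exists (M : metricType R) (f : X -> M), homeomorphism f.

Definition locally_connected : Prop :=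
  forall (x : X) (U : set X), nbhs x U ->
    exists V : set X, [/\ open V, V x, connected V & V `<=` U].

(* In a Hausdorff space these are the homeomorphic images of the circle. *)
Definition simple_closed_curve (A : set X) : Prop :=
  exists f : R -> X,
    [/\ {within `[0, 1], continuous f}, f 0 = f 1,
        {in `[0, 1[ &, injective f} & f @` `[0, 1] = A].

Definition arc_between (x y : X) (A : set X) : Prop :=
  exists f : R -> X,
    [/\ {within `[0, 1], continuous f}, {in `[0, 1] &, injective f},
        f 0 = x, f 1 = y & f @` `[0, 1] = A].

(* The points of (x, y); in a dendrite the arc A from x to y is unique. *)
Definition open_arc (x y : X) : set X :=
  [set z | [/\ z <> x, z <> y & exists2 A, arc_between x y A & A z]].

Definition continuum : Prop :=
  [/\ [set: X] !=set0, compact [set: X], connected [set: X] & metrizable].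

Definition dendrite : Prop :=
  [/\ continuum, locally_connected & ~ exists A, simple_closed_curve A].

Definition component_toward (x y : X) : set X :=
  connected_component (~` [set x]) y.

(* The set of connected components of X \ {x}. *)
Definition hat (x : X) : set (set X) :=
  [set component_toward x y | y in ~` [set x]].

Definition branch_point (x : X) : Prop := `I_3 #<= hat x.

End Dendrites.

(* The parameter n, with 3 <= n <= oo, is an [option nat] with None = oo. *)
Definition nat_below (m : nat) (n : option nat) : bool :=
  if n is Some k then (m < k)%N else true.

Definition at_least_three (n : option nat) : bool :=
  if n is Some k then (3 <= k)%N else true.

Definition initial (n : option nat) : Type := {m : nat | nat_below m n}.
HB.instance Definition _ n := SubCountable.on (initial n).

Definition wazewski_dendrite (R : realType) (n : option nat)
    (X : topologicalType) : Prop :=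
  [/\ dendrite R X,
      exists x y : X, x <> y,
      forall x : X, branch_point x -> hat x #= [set: initial n]
    & forall x y : X, x <> y ->
        exists2 z, open_arc R x y z & branch_point z].

Section Colorings.
Variables (X : topologicalType) (n : option nat).

(* [c x C] is the color of C in hat x; the values of c away from the disjoint
   union of the sets hat x, for x a branch point, are irrelevant. *)
Record coloring : Type := Coloring {
  color :> X -> set X -> initial n;
  colorP : forall x, branch_point x ->
    set_bij (hat x) [set: initial n] (color x) }.

Definition color_toward (c : coloring) (x y : X) : initial n :=
  c x (component_toward x y).

Definition kaleidoscopic (R : realType) (c : coloring) : Prop :=
  forall x y : X, branch_point x -> branch_point y -> x <> y ->
  forall i j : initial n, i <> j ->
    exists z, [/\ open_arc R x y z, branch_point z,
                  color_toward c z x = i & color_toward c z y = j].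

(* sigma_c(g, x); here [pinv (hat x) (c x)] is the inverse of c_x. *)
Definition local_action (c : coloring) (g : X -> X) (x : X) (i : initial n) :
    initial n :=
  c (g x) (g @` (pinv (hat x) (c x) i)).

Definition kaleidoscopic_pred (c : coloring)
    (Gamma : groupClosed (SymGroup (initial n))) : {pred SymGroup X} :=
  fun g => `[< homeomorphism g /\
    forall x, branch_point x ->
      exists2 gamma, gamma \in Gamma & gamma =1 local_action c g x >].

End Colorings.

Section KaleidoscopicGroup.
Variable X : topologicalType.
Implicit Types (g h : SymGroup X) (x y : X).

Lemma homeomorphism1 : homeomorphism (1%g : SymGroup X).
Proof. by exists idfun; split => // x; exact: cvg_id. Qed.

Lemma homeomorphismM g h :
  homeomorphism g -> homeomorphism h -> homeomorphism (g * h)%g.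
Proof.
case=> g' [gg' g'g cg cg'] [h' [hh' h'h ch ch']].
exists (h' \o g'); split.
- by move=> x /=; rewrite gg' hh'.
- by move=> x /=; rewrite h'h g'g.
- by move=> x; apply: continuous_comp; [exact: ch|exact: cg].
- by move=> x; apply: continuous_comp; [exact: cg'|exact: ch'].
Qed.

Lemma homeomorphismV g : homeomorphism g -> homeomorphism (g^-1)%g.
Proof.
case=> g' [gg' g'g cg cg'].
have -> : (g^-1)%g = g' :> (X -> X).
  by apply/funext => x; rewrite -{1}(g'g x); exact: symK.
by exists g; split.
Qed.

Lemma component_image_sub g x y : homeomorphism g -> y <> x ->
  g @` component_toward x y `<=` component_toward (g x) (g y).
Proof.
case=> g' [gg' g'g cg cg'] yx.
apply: connected_component_max.
- by exists y => //; apply: connected_component_refl.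
- by move=> _ [z /connected_component_sub zx <-] /(can_inj gg').
- apply: connected_continuous_connected; first exact: component_connected.
  exact: continuous_subspaceT.
Qed.

Lemma component_image g x y : homeomorphism g -> y <> x ->
  g @` component_toward x y = component_toward (g x) (g y).
Proof.
move=> hg yx; apply/seteqP; split; first exact: component_image_sub.
have gyx : g y <> g x by move=> /(bij_inj (symP g)).
move=> z zg.
have := @component_image_sub _ (g x) (g y) (homeomorphismV hg) gyx ((g^-1)%g z).
have e t : (g^-1)%g (g t) = t by exact: symK.
rewrite !e => k; exists ((g^-1)%g z); last exact: symVK.
by apply: k; exists z.
Qed.

Lemma hat_image g x : homeomorphism g -> forall C, hat x C -> hat (g x) (g @` C).
Proof.
move=> hg C [y yx <-]; rewrite component_image//; exists (g y) => //.
by move=> /(bij_inj (symP g)).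
Qed.

Lemma branch_image g x : homeomorphism g -> branch_point x -> branch_point (g x).
Proof.
move=> hg bx; apply: (card_le_trans bx).
have inj : {in hat x &, injective (fun C : set X => g @` C)}.
  move=> C D _ _ e; apply/funext => y.
  by rewrite -(image_inj (bij_inj (symP g))) e image_inj//; exact: bij_inj (symP g).
have /card_eqPle[_ le] := inj_card_eq inj.
apply: (card_le_trans le); apply: subset_card_le => _ [C hC <-]; exact: hat_image.
Qed.

Variables (n : option nat) (c : coloring X n).

(* Every i is c_x(C) for a component C, and then [local_action c g x i] is
   the color of the component g(C). *)
Lemma color_ex x i : branch_point x -> exists2 C, hat x C & c x C = i.
Proof.
by move=> bx; have [_ _ /(_ i I)[C hC e]] := colorP c bx; exists C.
Qed.

Lemma local_actionE (g : X -> X) x C : branch_point x -> hat x C ->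
  local_action c g x (c x C) = c (g x) (g @` C).
Proof.
move=> bx hC; have [_ ci _] := colorP c bx.
by rewrite /local_action pinvKV// inE.
Qed.

Lemma local_action1 x : branch_point x ->
  local_action c (1%g : SymGroup X) x =1 id.
Proof.
move=> bx i; have [C hC <-] := color_ex i bx.
by rewrite local_actionE//= image_id.
Qed.

Lemma local_actionM g h x : homeomorphism h -> branch_point x ->
  local_action c (g * h)%g x =1 local_action c g (h x) \o local_action c h x.
Proof.
move=> hh bx i; have [C hC <-] := color_ex i bx.
have bhx := branch_image hh bx; have hhC := hat_image hh hC.
by rewrite /= !local_actionE// image_comp.
Qed.

Variable Gamma : groupClosed (SymGroup (initial n)).

Lemma kaleidoscopic_group_closed : group_closed (kaleidoscopic_pred c Gamma).
Proof.
split.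
  apply/asboolP; split; first exact: homeomorphism1.
  move=> x bx; exists 1%g; first exact: gpred1.
  by move=> i; rewrite local_action1.
move=> g h /asboolP[hg Kg] /asboolP[hh Kh]; apply/asboolP.
have hV := homeomorphismV hh.
split; first exact: homeomorphismM.
move=> x bx; set y := (h^-1)%g x.
have hyx : h y = x by exact: symVK.
have by_ : branch_point y by exact: branch_image.
have [a Ga ea] := Kg _ by_; have [b Gb eb] := Kh _ by_.
exists (a / b)%g; first exact: gpredF.
move=> i; rewrite local_actionM//= -/y -ea; congr (a _).
apply: (bij_inj (symP b)); rewrite symVK eb.
have := @local_actionM h (h^-1)%g x hV bx i.
by rewrite mulgV local_action1.
Qed.

End KaleidoscopicGroup.

Section KaleidoscopicGroupType.
Variables (X : topologicalType) (n : option nat) (c : coloring X n).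
Variable Gamma : groupClosed (SymGroup (initial n)).

Record kaleidoscopic_group : Type := KaleidoscopicGroup {
  kg_sym :> SymGroup X;
  kg_mem : kg_sym \in kaleidoscopic_pred c Gamma }.

HB.instance Definition _ := [isSub for kg_sym].
HB.instance Definition _ := [Choice of kaleidoscopic_group by <:].
HB.instance Definition _ := SubChoice_isSubGroup.Build _ _ kaleidoscopic_group
  (kaleidoscopic_group_closed c Gamma).

End KaleidoscopicGroupType.

(* Main.v *)
From HB Require Import structures.
Require Import Defs.
From mathcomp Require Import all_boot all_order all_algebra.
From mathcomp Require Import zify ring lra.
From mathcomp Require Import freeg.
From mathcomp Require Import all_classical all_reals topology normedtype derive.

(* Let Gamma act on the set of colors. Orbits of Gamma on ordered pairs give
   alternating Gamma-invariant kernels alpha; if Gamma is neither generously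
   transitive nor semi-generous, one of them is not a coboundary on triples:
   d alpha (i, j, k) <> 0. Evaluating d alpha on the three colors seen from the
   median of three branch points x, y, w defines an invariant cocycle
   omega(x, y, w), hence a class in H^2(K(Gamma), Z), and it suffices to find a
   2-cycle on which omega is nonzero.

   If g preserves the colors and is supported in a half-tree hanging at a, the
   swindle G1 = g (t g t^-1) (t^2 g t^-2) ... makes g a commutator of elements on
   which omega based at a vanishes. So modulo boundaries [g] is worth
   omega(x, g x, a) for the base point x. For branch points a1, b, a2, a3 one has
   f3 = f2 h with f2, f3, h supported in half-trees at a2, a3, a1 and
   f2 a1 = f3 a1 = b; this relation is a 2-cycle of value
   omega(a1, b, a3) - omega(a1, b, a2), and kaleidoscopicity lets the colors at
   the two medians be (i, j, k) and (j, i, k), so the value is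
   2 d alpha (i, j, k).

   The automorphisms come from a back-and-forth argument on the countable set of
   branch points and extend to homeomorphisms because the components of the
   complements of branch points generate the topology. *)

Set Implicit Arguments.
Unset Strict Implicit.
Unset Printing Implicit Defensive.

Import Order.TTheory GRing.Theory Num.Theory.
Import numFieldTopology.Exports numFieldNormedType.Exports.

Local Open Scope ring_scope.

(** * Color-preserving automorphisms of the tree of branch points *)

(* [e z x] is the color at z of the component of the complement of z containing
   x, and [None] if x = z. *)
Record kaleidoscopic_tree (B : choiceType) (I : eqType)
    (e : B -> B -> option I) : Prop := KaleidoscopicTree {
  kt_none : forall z x, (e z x == None) = (x == z);
  kt_sep : forall z z' x, z != z' -> e z x != e z z' -> e z' x = e z' z;
  kt_med : forall x y w, x != y -> y != w -> x != w ->
    exists m, [/\ e m x != e m y, e m y != e m w & e m x != e m w];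
  kt_kal : forall x y i j, x != y -> i != j ->
    exists z, e z x = Some i /\ e z y = Some j;
  kt_dir : forall z i, exists x, e z x = Some i;
  kt_colors : exists i j k : I, [/\ i != j, j != k & i != k];
  kt_enum : exists u : nat -> B, forall b, exists k, u k = b }.

Section Tree.
Variables (B : choiceType) (I : eqType) (e : B -> B -> option I).
Hypothesis K : kaleidoscopic_tree e.

Definition tree_aut (f : B -> B) : Prop :=
  bijective f /\ forall z x, e (f z) (f x) = e z x.

Lemma e_self z : e z z = None.
Proof. by apply/eqP; rewrite (kt_none K). Qed.

Lemma e_some z x : x != z -> exists i, e z x = Some i.
Proof. by rewrite -(kt_none K); case: (e z x) => [i _|//]; exists i. Qed.

Lemma e_neq z x i : e z x = Some i -> x != z.
Proof. by rewrite -(kt_none K) => ->. Qed.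

Lemma e_neq2 z x y : e z x != e z y -> x != y.
Proof. by apply: contraNneq => ->. Qed.

Lemma other_color (i : I) : exists j, i != j.
Proof.
have [a [b [c [ab bc ac]]]] := kt_colors K.
by have [ia|] := eqVneq i a; [exists b; rewrite ia|exists a].
Qed.

Lemma third_color (i j : I) : exists k, (k != i) && (k != j).
Proof.
have [a [b [c [ab bc ac]]]] := kt_colors K.
have [ai|ai] := eqVneq a i; have [aj|aj] := eqVneq a j.
- by exists b; rewrite -{1}ai -aj eq_sym ab.
- have [bj|bj] := eqVneq b j; last by exists b; rewrite -{1}ai eq_sym ab.
  by exists c; rewrite -ai -bj !(eq_sym c) ac.
- have [bi|bi] := eqVneq b i; last by exists b; rewrite bi -aj eq_sym ab.
  by exists c; rewrite -aj -bi !(eq_sym c) ac bc.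
- by exists a; rewrite ai.
Qed.

(** For some y of color i at z, kaleidoscopicity gives v between z and y with color q towards z and
    another color towards y; then v and y lie on the same side of z. *)
Lemma leaf_exists z i q : exists v, e z v = Some i /\ e v z = Some q.
Proof.
have [y zy] := kt_dir K z i; have [j qj] := other_color q.
have yz : z != y by rewrite eq_sym; exact: e_neq zy.
have [v [vz vy]] := kt_kal K yz qj.
exists v; split=> //; rewrite -zy; apply/esym/(kt_sep K).
  by rewrite eq_sym; exact: e_neq vz.
by rewrite vz vy eq_sym; apply: contraNneq qj => -[->].
Qed.

(** * Back-and-forth between finite median-closed sets *)

Definition median_closed (F : seq B) : Prop := forall x y w m,
  x \in F -> y \in F -> w \in F ->
  e m x != e m y -> e m y != e m w -> e m x != e m w -> m \in F.

Lemma median_closed_cons v F : median_closed F ->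
  (forall x y m, x \in F -> y \in F -> e m v != e m x -> e m v != e m y ->
    e m x != e m y -> m \in v :: F) ->
  median_closed (v :: F).
Proof.
move=> mF H x y w m; rewrite ![_ \in v :: F]inE.
move=> /predU1P[->|xF] /predU1P[->|yF] /predU1P[->|wF] xy yw xw;
  rewrite ?eqxx// in xy yw xw *.
- by rewrite -in_cons; apply: (H y w).
- by rewrite -in_cons; apply: (H x w) => //; rewrite eq_sym.
- by rewrite -in_cons; apply: (H x y) => //; rewrite eq_sym.
- by rewrite (mF x y w m) ?orbT.
Qed.

(** Here v hangs off F at a. In a median of v with two points of F, a can replace v unless the
    median separates a from v; but then both points lie beyond a and have equal colors at the
    median. *)
Lemma median_closed_leaf F a v : median_closed F -> a \in F ->
  (forall f, f \in F -> e a f != e a v) -> median_closed (v :: F).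
Proof.
move=> mF aF H; apply: median_closed_cons => // x y m xF yF vx vy xy.
rewrite inE; have [//|mv] := eqVneq m v.
have [->|ma] := eqVneq m a; first exact: aF.
have [mav|mav] := eqVneq (e m a) (e m v).
  by apply: (mF a x y) => //; rewrite mav.
have av : e a v = e a m by apply: (kt_sep K) => //; rewrite eq_sym.
have xa : e m x = e m a.
  by apply: (kt_sep K); rewrite 1?eq_sym// eq_sym -av; apply: H.
have ya : e m y = e m a.
  by apply: (kt_sep K); rewrite 1?eq_sym// eq_sym -av; apply: H.
by rewrite xa ya eqxx in xy.
Qed.

(** Here v lies between a and b. A point other than v cannot separate v from both of them, so one of
    them can replace v in any new median. *)
Lemma median_closed_edge F a b v : median_closed F -> a \in F -> b \in F ->
  e v a != e v b -> median_closed (v :: F).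
Proof.
move=> mF aF bF vab; apply: median_closed_cons => // x y m xF yF vx vy xy.
rewrite inE; have [//|mv] := eqVneq m v.
have [mav|mav] := eqVneq (e m a) (e m v).
  by apply: (mF a x y) => //; rewrite mav.
have [mbv|mbv] := eqVneq (e m b) (e m v).
  by apply: (mF b x y) => //; rewrite mbv.
by rewrite (kt_sep K mv mav) (kt_sep K mv mbv) eqxx in vab.
Qed.

(** The point a plays the role of the projection of v to F. The induction keeps it unless the new
    point sees a and v in different directions, in which case the new point takes over. *)
Lemma nearest v (F : seq B) a0 : a0 \in F ->
  exists2 a, a \in F & forall f, f \in F -> f != a -> e f v = e f a.
Proof.
case: F => // b F _; elim: F b => [|b F IH] b0.
  by exists b0; rewrite ?inE// => f; rewrite inE => /eqP ->; rewrite eqxx.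
have [a aF H] := IH b.
have [b0a|b0a] := eqVneq b0 a.
  exists a; rewrite ?inE -?b0a ?eqxx//.
  move=> f; rewrite inE => /predU1P[->|fF]; rewrite b0a ?eqxx//; exact: H.
have [ev|ev] := eqVneq (e b0 v) (e b0 a).
  exists a; first by rewrite inE aF orbT.
  by move=> f; rewrite inE => /predU1P[->//|]; exact: H.
exists b0; first by rewrite inE eqxx.
move=> f; rewrite inE => /predU1P[->|fF fb0]; rewrite ?eqxx//.
have [->|fa] := eqVneq f a; first exact: (kt_sep K).
have b0f : b0 != f by rewrite eq_sym.
have [E|N] := eqVneq (e b0 v) (e b0 f); last exact: (kt_sep K).
by rewrite (H _ fF fa); apply: (kt_sep K) => //; rewrite -E eq_sym.
Qed.

Definition partial_iso (L : seq (B * B)) : Prop :=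
  forall p q, p \in L -> q \in L -> e p.1 q.1 = e p.2 q.2.

(** Median closure keeps the position of a further vertex simple: it hangs off one point, or is
    attached to a segment between two adjacent points, and few colors then force all others. *)
Definition good (L : seq (B * B)) : Prop :=
  [/\ partial_iso L, median_closed (map fst L) & median_closed (map snd L)].

Definition swap (L : seq (B * B)) : seq (B * B) := [seq (p.2, p.1) | p <- L].

Lemma swap_mem p L : (p \in swap L) = ((p.2, p.1) \in L).
Proof.
apply/mapP/idP => [[[a b] abL ->]//|pL].
by exists (p.2, p.1) => //; case: p pL.
Qed.

Lemma good_swap L : good L -> good (swap L).
Proof.
case=> iL m1 m2; split.
- by move=> p q; rewrite !swap_mem => pL qL; have /= := iL _ _ pL qL.
- by rewrite -map_comp (_ : map _ L = map snd L).
- by rewrite -map_comp (_ : map _ L = map fst L).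
Qed.

Lemma iso_neq L p q : partial_iso L -> p \in L -> q \in L ->
  (p.1 == q.1) = (p.2 == q.2).
Proof. by move=> iL pL qL; rewrite -!(kt_none K) iL. Qed.

Lemma partial_iso_cons L v v' : partial_iso L ->
  (forall p, p \in L -> e v p.1 = e v' p.2 /\ e p.1 v = e p.2 v') ->
  partial_iso ((v, v') :: L).
Proof.
move=> iL H p q; rewrite !inE => /predU1P[->|pL] /predU1P[->|qL] /=.
- by rewrite !e_self.
- by case: (H q qL).
- by case: (H p pL).
- exact: iL.
Qed.

(** Only the two colors between a and v need copying, which [leaf_exists] does at a'; separation
    forces every other color. *)
Lemma good_leaf L a a' v : good L -> (a, a') \in L ->
  (forall p, p \in L -> e a p.1 != e a v) -> exists v', good ((v, v') :: L).
Proof.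
case=> iL m1 m2 aL H.
have va : v != a by rewrite eq_sym; apply: e_neq2 (H _ aL).
have av : a != v by rewrite eq_sym.
have [i avi] := e_some va; have [q vaq] := e_some av.
have [v' [av' va']] := leaf_exists a' i q.
have H' p : p \in L -> e a' p.2 != e a' v'.
  by move=> pL; rewrite av' -avi -[_ a' _](iL _ _ aL pL); apply: H.
have a'v' : a' != v' by apply: e_neq va'.
exists v'; split=> /=.
- apply: partial_iso_cons => // p pL; split.
    rewrite (kt_sep K _ (H _ pL))// (kt_sep K _ (H' _ pL))//.
    by rewrite vaq va'.
  have [pa|pa] := eqVneq a p.1.
    have pa' : a' == p.2 by rewrite -(iso_neq iL aL pL) /= pa.
    by rewrite -pa -(eqP pa') avi av'.
  have pa' : a' != p.2 by rewrite -(iso_neq iL aL pL).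
  rewrite [LHS](kt_sep K pa) 1?eq_sym ?H// [RHS](kt_sep K pa') 1?eq_sym ?H'//.
  exact: iL _ _ pL aL.
- apply: (@median_closed_leaf _ a) => //; first exact: (map_f fst aL).
  by move=> _ /mapP[p pL ->]; exact: H.
- apply: (@median_closed_leaf _ a') => //; first exact: (map_f snd aL).
  by move=> _ /mapP[p pL ->]; exact: H'.
Qed.

(** For a and b adjacent in F and v between them, how v and a point of F see each other is read off
    from the end behind which that point lies. *)
Lemma edge_dir F a b v : median_closed F -> a \in F -> b \in F -> a != b ->
  (forall f, f \in F -> f != a -> f != b -> e f a = e f b) ->
  e v a != e v b -> v != a -> v != b -> forall p, p \in F ->
  [/\ p != v, e a p != e a b -> e v p = e v a,
     e b p != e b a -> e v p = e v b &
     p != a -> p != b -> e p v = e p a].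
Proof.
move=> mF aF bF ab H vab va vb p pF.
have pv : p != v.
  by apply: contraNneq vab => pv; rewrite H// -pv.
have av : e a b = e a v by apply: (kt_sep K) => //; rewrite eq_sym.
have bv : e b a = e b v by apply: (kt_sep K).
split=> //.
- by rewrite av; apply: (kt_sep K); rewrite eq_sym.
- by rewrite bv; apply: (kt_sep K); rewrite eq_sym.
- move=> pa pb; have vp : v != p by rewrite eq_sym.
  have [E|N] := eqVneq (e v a) (e v p); last exact/esym/(kt_sep K).
  by rewrite H//; apply/esym/(kt_sep K) => //; rewrite -E eq_sym.
Qed.

(** Otherwise the median of p, a and b would be a third point of F separating the adjacent points a
    and b. *)
Lemma edge_side F a b p : median_closed F -> a \in F -> b \in F -> a != b ->
  (forall f, f \in F -> f != a -> f != b -> e f a = e f b) -> p \in F ->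
  (e a p != e a b) || (e b p != e b a).
Proof.
move=> mF aF bF ab H pF; apply/orP.
have [E1|] := eqVneq (e a p) (e a b); last by left.
have [E2|] := eqVneq (e b p) (e b a); last by right.
have pa : p != a.
  by rewrite -(kt_none K) E1 (kt_none K) eq_sym.
have pb : p != b by rewrite -(kt_none K) E2 (kt_none K).
have [m [m1 m2 m3]] := kt_med K pa ab pb.
have mm : m \in F by apply: (mF p a b).
have ma : m != a by apply: contraNneq m3 => ->; rewrite E1.
have mb : m != b by apply: contraNneq m1 => ->; rewrite E2.
by rewrite H ?eqxx in m2.
Qed.

Lemma good_edge L a a' b b' v : good L -> (a, a') \in L -> (b, b') \in L ->
  (forall p, p \in L -> p.1 != a -> p.1 != b -> e p.1 a = e p.1 b) ->
  e v a != e v b -> v != a -> v != b -> exists v', good ((v, v') :: L).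
Proof.
case=> iL m1 m2 aL bL H vab va vb.
have av : a != v by rewrite eq_sym.
have bv : b != v by rewrite eq_sym.
have ab : a != b by apply: e_neq2 vab.
have ab' : a' != b' by rewrite -(iso_neq iL aL bL).
have [i vai] := e_some av; have [j vbj] := e_some bv.
have ij : i != j by move: vab; rewrite vai vbj; apply: contraNneq => ->.
have [v' [vai' vbj']] := kt_kal K ab' ij.
have vab' : e v' a' != e v' b' by rewrite vai' vbj' -vai -vbj.
have va' : v' != a' by rewrite eq_sym; apply: e_neq vai'.
have vb' : v' != b' by rewrite eq_sym; apply: e_neq vbj'.
have aF := map_f fst aL; have bF := map_f fst bL.
have aF' := map_f snd aL; have bF' := map_f snd bL.
have HF f : f \in map fst L -> f != a -> f != b -> e f a = e f b.
  by move=> /mapP[p pL ->]; exact: H.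
have HF' f : f \in map snd L -> f != a' -> f != b' -> e f a' = e f b'.
  move=> /mapP[p pL ->] pa pb.
  rewrite -[LHS](iL _ _ pL aL) -[RHS](iL _ _ pL bL) H//.
  - by rewrite (iso_neq iL pL aL).
  - by rewrite (iso_neq iL pL bL).
have ave : e a b = e a v by apply: (kt_sep K) => //; rewrite eq_sym.
have bve : e b a = e b v by apply: (kt_sep K).
have ave' : e a' b' = e a' v' by apply: (kt_sep K) => //; rewrite eq_sym.
have bve' : e b' a' = e b' v' by apply: (kt_sep K).
exists v'; split=> /=.
- apply: partial_iso_cons => // p pL.
  have pF := map_f fst pL; have pF' := map_f snd pL.
  have [pv pA pB pv0] := edge_dir m1 aF bF ab HF vab va vb pF.
  have [pv' pA' pB' pv0'] := edge_dir m2 aF' bF' ab' HF' vab' va' vb' pF'.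
  split.
    have /orP[s|s] := edge_side m1 aF bF ab HF pF.
      rewrite pA// pA' ?vai ?vai'//.
      by rewrite -[e a' _](iL _ _ aL pL) -[e a' b'](iL _ _ aL bL).
    rewrite pB// pB' ?vbj ?vbj'//.
    by rewrite -[e b' _](iL _ _ bL pL) -[e b' a'](iL _ _ bL aL).
  have [pa|pa] := eqVneq p.1 a.
    have /eqP pa' : p.2 == a' by rewrite -(iso_neq iL pL aL) /= pa.
    by rewrite pa pa' -ave -ave' [LHS](iL _ _ aL bL).
  have [pb|pb] := eqVneq p.1 b.
    have /eqP pb' : p.2 == b' by rewrite -(iso_neq iL pL bL) /= pb.
    by rewrite pb pb' -bve -bve' [LHS](iL _ _ bL aL).
  rewrite pv0// pv0'; first exact: (iL _ _ pL aL).
  - by rewrite -(iso_neq iL pL aL).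
  - by rewrite -(iso_neq iL pL bL).
- exact: (median_closed_edge m1 aF bF).
- exact: (median_closed_edge m2 aF' bF').
Qed.

(** Let a be the domain point nearest to v. If no domain point lies in the direction of v at a, then
    v is a leaf there. Otherwise let b be the one nearest to a in that direction: v either lies
    between a and b or branches off at the median m of v, a, b, which is inserted first. *)
Lemma good_extend L p0 v : p0 \in L -> good L ->
  exists L', [/\ good L', {subset L <= L'} & v \in map fst L'].
Proof.
move=> p0L gL; have [iL m1 m2] := gL.
have [vF|vF] := boolP (v \in map fst L); first by exists L; split.
have [a aF Ha] := @nearest v _ _ (map_f fst p0L).
have /mapP[[a1 a'] aL /= aa] := aF; rewrite -{a1}aa in aL.
have subL w : {subset L <= w :: L} by move=> x xL; rewrite inE xL orbT.
have [[b0 b0F]|noF] := pselect (exists b, b \in [seq f <- map fst L | e a f == e a v]);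
  last first.
  have [|v' gv] := good_leaf (v := v) gL aL.
    move=> p pL; apply/negP => E; apply: noF; exists p.1.
    by rewrite mem_filter E map_f.
  by exists ((v, v') :: L); split=> //=; rewrite inE eqxx.
have [b bF' Hb] := @nearest a _ _ b0F.
move: bF'; rewrite mem_filter => /andP[/eqP abv bF].
have va : v != a by apply: contraNneq vF => ->.
have vb : v != b by apply: contraNneq vF => ->.
have ba : b != a by rewrite -(kt_none K) abv (kt_none K).
have ab : a != b by rewrite eq_sym.
have /mapP[[b1 b'] bL /= bb] := bF; rewrite -{b1}bb in bL.
have HF f : f \in map fst L -> f != a -> f != b -> e f a = e f b.
  move=> fF fa fb; have [E|N] := eqVneq (e a f) (e a v).
    by apply: Hb => //; rewrite mem_filter E eqxx.
  by apply/esym/(kt_sep K); rewrite 1?eq_sym// abv.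
have HL p : p \in L -> p.1 != a -> p.1 != b -> e p.1 a = e p.1 b.
  by move=> pL; apply: HF; exact: map_f.
have [vab|vab] := eqVneq (e v a) (e v b); last first.
  have [v' gv] := good_edge gL aL bL HL vab va vb.
  by exists ((v, v') :: L); split=> //=; rewrite inE eqxx.
have [m [mva mab mvb]] := kt_med K va ab vb.
have ma : m != a by apply: contraNneq mvb => ->; rewrite abv.
have mb : m != b by apply: contraNneq mva => ->; rewrite (Ha _ bF ba).
have [m' gm] := good_edge gL aL bL HL mab ma mb.
have [|v' gv] := good_leaf (v := v) gm (mem_head _ _).
  move=> p; rewrite inE => /predU1P[->/=|pL].
    by rewrite e_self eq_sym (kt_none K); apply: contraNneq mab => <-; rewrite vab.
  apply/eqP => E; have : m \in map fst L.
    by apply: (m1 p.1 a b); rewrite ?E//; exact: map_f.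
  by move=> /HF - /(_ ma mb) /eqP; rewrite (negbTE mab).
exists ((v, v') :: (m, m') :: L); split=> //=; last by rewrite inE eqxx.
by move=> x xL; rewrite !inE xL !orbT.
Qed.

Lemma good_extend2 L p0 v : p0 \in L -> good L ->
  exists L', [/\ good L', {subset L <= L'}, v \in map fst L' & v \in map snd L'].
Proof.
move=> p0L gL; have [L1 [g1 s1 v1]] := good_extend v p0L gL.
have p1 : (p0.2, p0.1) \in swap L1 by rewrite swap_mem /= -surjective_pairing s1.
have [L2 [g2 s2 v2]] := good_extend v p1 (good_swap g1).
exists (swap L2); split; first exact: good_swap.
- move=> p /s1 pL; rewrite swap_mem; apply: s2.
  by rewrite swap_mem /= -surjective_pairing.
- case/mapP: v1 => p pL ->; apply/mapP; exists p => //.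
  by rewrite swap_mem; apply: s2; rewrite swap_mem /= -surjective_pairing.
- case/mapP: v2 => p pL ->; apply/mapP; exists (p.2, p.1) => //.
  by rewrite swap_mem -surjective_pairing.
Qed.

(** Stage k+1 of the chain has [u k] both in its domain and in its range, so the union of the stages
    is the graph of an automorphism. *)
Lemma good_aut L p0 : p0 \in L -> good L ->
  exists2 f, tree_aut f & forall p, p \in L -> f p.1 = p.2.
Proof.
move=> p0L gL; have [u uP] := kt_enum K.
have step (M : {M | p0 \in M /\ good M}) (v : B) : {M' : {M | p0 \in M /\ good M} |
    [/\ {subset sval M <= sval M'}, v \in map fst (sval M') & v \in map snd (sval M')]}.
  case: M => M [pM gM]; apply: cid.
  have [M' [gM' sM' a b]] := good_extend2 v pM gM.
  by exists (exist _ M' (conj (sM' _ pM) gM')).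
pose fix chain k : {M | p0 \in M /\ good M} :=
  if k is k'.+1 then sval (step (chain k') (u k')) else exist _ L (conj p0L gL).
have mono k l : (k <= l)%N -> {subset sval (chain k) <= sval (chain l)}.
  elim: l => [|l IH]; first by rewrite leqn0 => /eqP ->.
  rewrite leq_eqVlt => /predU1P[-> //|kl] x /(IH kl) xl /=.
  by case: (step _ _) => M' /= [s _ _]; apply: s.
pose Rl v v' := exists k, (v, v') \in sval (chain k).
have RlE p q : Rl p.1 p.2 -> Rl q.1 q.2 -> e p.1 q.1 = e p.2 q.2.
  case=> k kp [l lq]; have [_ [iM _ _]] := svalP (chain (maxn k l)).
  apply: iM; rewrite [p in p \in _]surjective_pairing.
    exact: mono (leq_maxl _ _) _ kp.
  by rewrite [q in q \in _]surjective_pairing; exact: mono (leq_maxr _ _) _ lq.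
have Rtot v : exists v', Rl v v'.
  have [k <-] := uP v.
  suff : u k \in map fst (sval (chain k.+1)).
    by move=> /mapP[[a b] ab /= ->]; exists b, k.+1.
  by rewrite /=; case: (step _ _) => M' /= [].
have Rsurj v' : exists v, Rl v v'.
  have [k <-] := uP v'.
  suff : u k \in map snd (sval (chain k.+1)).
    by move=> /mapP[[a b] ab /= ->]; exists a, k.+1.
  by rewrite /=; case: (step _ _) => M' /= [].
have [f fP] := choice Rtot; have [g gP] := choice Rsurj.
have Rfun v v1 v2 : Rl v v1 -> Rl v v2 -> v2 = v1.
  move=> r1 r2; apply/eqP; rewrite -(kt_none K).
  by rewrite -(RlE (v, v1) (v, v2) r1 r2) e_self.
have Rinj v v1 v2 : Rl v1 v -> Rl v2 v -> v2 = v1.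
  move=> r1 r2; apply/eqP; rewrite -(kt_none K).
  by rewrite (RlE (v1, v) (v2, v) r1 r2) e_self.
exists f; first split.
- by exists g => x; [apply: Rinj (fP _) (gP _)|apply: Rfun (gP _) (fP _)].
- by move=> z x; rewrite -(RlE (z, f z) (x, f x)).
- by move=> p pL; apply: Rfun (fP _); exists 0%N; rewrite -surjective_pairing.
Qed.

(** A two-point set is median closed, so the two mutual colors are the only obstruction. *)
Lemma aut_pair x y x' y' : e x y = e x' y' -> e y x = e y' x' ->
  exists f, [/\ tree_aut f, f x = x' & f y = y'].
Proof.
move=> h1 h2; pose L := [:: (x, x'); (y, y')].
have mc2 (a b : B) : median_closed [:: a; b].
  move=> p q r m; rewrite !inE.
  by move=> /orP[]/eqP-> /orP[]/eqP-> /orP[]/eqP->; rewrite ?eqxx.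
have gL : good L.
  split; [|exact: mc2|exact: mc2].
  apply: partial_iso_cons; first by apply: partial_iso_cons.
  by move=> p; rewrite inE => /eqP ->.
have [f fa fL] := good_aut (mem_head _ _) gL; exists f; split=> //.
- by apply: (fL (x, x')); rewrite inE eqxx.
- by apply: (fL (y, y')); rewrite !inE eqxx orbT.
Qed.

Lemma aut_point x x' : exists2 f, tree_aut f & f x = x'.
Proof.
have E : e x x = e x' x' by rewrite !e_self.
by have [f [fa fx _]] := aut_pair E E; exists f.
Qed.

(** * Gluing and swindling automorphisms *)

Lemma aut_id : tree_aut id.
Proof. by split=> //; exists id. Qed.

Lemma aut_comp f g : tree_aut f -> tree_aut g -> tree_aut (f \o g).
Proof.
move=> [bf ef] [bg eg]; split; first exact: bij_comp.
by move=> z x /=; rewrite ef eg.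
Qed.

Lemma aut_can f g : tree_aut f -> cancel f g -> tree_aut g.
Proof.
move=> [bf ef] fg; have gf : cancel g f by apply/(bij_can_sym bf).
split; first by exists f.
by move=> z x; rewrite -ef !gf.
Qed.

Lemma aut_surj f : (forall z x, e (f z) (f x) = e z x) ->
  (forall y, exists x, f x = y) -> tree_aut f.
Proof.
move=> ef /choice[g fg]; split=> //; exists g => // x.
by apply/eqP; rewrite -(kt_none K) -ef fg e_self.
Qed.

Lemma aut_iter k f : tree_aut f -> tree_aut (iter k f).
Proof.
move=> af; elim: k => [|k IH]; first exact: aut_id.
exact: (aut_comp af IH).
Qed.

(** Both maps carry the half-tree of color p at a onto the one of color p at the common image of a,
    and points on different sides see each other in the direction of a. *)
Lemma aut_glue g h a p : tree_aut g -> tree_aut h -> g a = h a ->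
  tree_aut (fun v => if e a v == Some p then g v else h v).
Proof.
move=> [bg eg] [bh eh] gh; apply: aut_surj.
  have neq z x : e a z == Some p -> e a x != Some p -> e a x != e a z.
    by move=> /eqP ->.
  move=> z x; case: ifPn => zp; case: ifPn => xp //.
    have az : a != z by rewrite eq_sym; apply: e_neq (eqP zp).
    have gaz : g a != g z by rewrite (bij_eq bg).
    rewrite (kt_sep K az (neq _ _ zp xp)) -(eg z a).
    by apply: (kt_sep K) => //; rewrite {1}gh eg eh neq.
  have [<-|az] := eqVneq a z; first by rewrite -gh eg.
  have haz : h a != h z by rewrite (bij_eq bh).
  rewrite (kt_sep K az) 1?eq_sym ?neq// -(eh z a).
  by apply: (kt_sep K) => //; rewrite -{1}gh eg eh eq_sym neq.
move=> y; have [yp|yp] := boolP (e (g a) y == Some p).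
  have [g' _ g'g] := bg; exists (g' y).
  by rewrite -eg g'g yp.
have [h' _ h'h] := bh; exists (h' y).
by rewrite -eh h'h -gh (negbTE yp).
Qed.

(* The half-tree at u containing a is moved into the half-tree of color q at a. *)
Lemma contraction a p : exists t q, [/\ tree_aut t, q != p &
  forall v, (e a v == Some p) || (e a v == Some q) -> e a (t v) = Some q].
Proof.
have [q pq] := other_color p; have [q2 /andP[q2p q2q]] := third_color p q.
have [u au] := kt_dir K a q2.
have ua := e_neq au; have a_u : a != u by rewrite eq_sym.
have [r uar] := e_some a_u.
(* The image half-tree has color r at u'. Since u' sees a under r', different from r, it misses a
   and so lies in color q at a. *)
have [r' rr'] := other_color r.
have [u' [au' u'a]] := leaf_exists a q r'.
have u'_a := e_neq au'.
have [t ta tu] := aut_point u u'.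
exists t, q; split=> //; first by rewrite eq_sym.
move=> v Hv; rewrite -au'; apply: (kt_sep K) => //.
rewrite -[in X in X != _]tu ta.2 u'a (kt_sep K a_u) ?uar; last first.
  rewrite au; apply: contraTneq Hv => ->; rewrite negb_or.
  by apply/andP; split; [apply: contraNneq q2p|apply: contraNneq q2q] => -[->].
by apply: contraNneq rr' => -[->].
Qed.

Lemma swindle a p g : tree_aut g -> (forall v, e a v != Some p -> g v = v) ->
  exists t G1 G2, [/\ tree_aut t, tree_aut G1 /\ tree_aut G2,
    G1 a = a /\ G2 a = a, G1 =1 g \o G2 & t \o G1 =1 G2 \o t].
Proof.
move=> ag gfix; have [t [q [at_ qp tW]]] := contraction a p.
have [[s ts st] _] := at_; have as_ := aut_can at_ ts.
(* [S k] is the image of the half-tree supporting g under the k-th power of t; the conjugate [h k]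
   is supported in it. *)
pose S k v := e a (iter k s v) == Some p.
pose h k := iter k t \o g \o iter k s.
have ah k : tree_aut (h k).
  by apply: aut_comp; [apply: aut_comp => //|]; exact: aut_iter.
have tsk k : cancel (iter k t) (iter k s).
  by elim: k => // k IH v; rewrite iterSr iterS ts IH.
have stk k : cancel (iter k s) (iter k t).
  by elim: k => // k IH v; rewrite iterSr iterS st IH.
have ga : g a = a by apply: gfix; rewrite e_self.
have hS k v : S k (h k v) = S k v.
  by rewrite /S /h /= tsk -{1}ga ag.2.
have hfix k v : ~~ S k v -> h k v = v.
  by move=> Sv; rewrite /h /= gfix ?stk.
(* The first application of t moves color p into color q, and later ones stay in color q. As q
   differs from p, the supports [S k] are pairwise disjoint. *)
have tSW k v : e a v = Some p -> e a (iter k.+1 t v) = Some q.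
  move=> av; elim: k => [|k IH]; first by apply: tW; rewrite av eqxx.
  by rewrite iterS; apply: tW; rewrite IH eqxx orbT.
have disj k l v : (k < l)%N -> S k v -> S l v -> False.
  move=> kl /eqP Sk /eqP Sl; have := tSW (l - k).-1 _ Sl.
  rewrite prednK ?subn_gt0// -[l in iter l s v](subnK (ltnW kl)) iterD stk Sk.
  by move=> [pq]; rewrite pq eqxx in qp.
have disj' k l v : k != l -> S k v -> S l v -> False.
  rewrite neq_ltn => /orP[kl|lk] Sk Sl; first exact: disj kl Sk Sl.
  exact: disj lk Sl Sk.
have aS k : ~~ S k a.
  apply/negP; case: k => [|k] /eqP Sk; first by rewrite /= e_self in Sk.
  by have := tSW k _ Sk; rewrite stk e_self.
(* F 0 and F 1 are the infinite products of the h k over k >= 0 and k >= 1. *)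
pose F j v := if pselect (exists k, (j <= k)%N && S k v) is left E
              then h (sval (cid E)) v else v.
have FS j k v : (j <= k)%N -> S k v -> F j v = h k v.
  move=> jk Sk; rewrite /F; case: pselect => [E|]; last first.
    by case; exists k; rewrite jk.
  case: (cid E) => l /= /andP[_ Sl]; have [->//|kl] := eqVneq k l.
  by have := disj' _ _ _ kl Sk Sl.
have FN j v : (forall k, (j <= k)%N -> ~~ S k v) -> F j v = v.
  move=> N; rewrite /F; case: pselect => // E; have [k /andP[jk Sk]] := E.
  by have := N _ jk; rewrite Sk.
have Fcase j v : (exists2 k, (j <= k)%N & S k v) \/
      F j v = v /\ forall k, (j <= k)%N -> ~~ S k v.
  have [[k /andP[jk Sk]]|N] := pselect (exists k, (j <= k)%N && S k v).
    by left; exists k.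
  have N' k : (j <= k)%N -> ~~ S k v.
    by move=> jk; apply/negP => Sk; apply: N; exists k; rewrite jk.
  by right; split=> //; apply: FN.
have aF j : tree_aut (F j).
  apply: aut_surj.
    move=> z x; have [[k jk Sk]|[Fz _]] := Fcase j z;
      have [[l jl Sl]|[Fx _]] := Fcase j x.
    - have [kl|kl] := eqVneq k l.
        by rewrite -kl in jl Sl; rewrite !(FS j k)// (ah k).2.
      rewrite (FS j k)// (FS j l)//.
      have <- : h l (h k z) = h k z.
        by apply: hfix; apply/negP => Slh; apply: (disj' k l (h k z)); rewrite ?hS.
      have {1}<- : h k x = x by apply: hfix; apply/negP => Sk'; exact: (disj' k l x).
      by rewrite (ah l).2 (ah k).2.
    - rewrite Fx (FS j k)//; have [Skx|Skx] := boolP (S k x).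
        by rewrite -[in X in e _ X = _]Fx (FS j k)// (ah k).2.
      by rewrite -{1}(hfix k x Skx) (ah k).2.
    - rewrite Fz (FS j l)//; have [Slz|Slz] := boolP (S l z).
        by rewrite -[in X in e X _ = _]Fz (FS j l)// (ah l).2.
      by rewrite -{1}(hfix l z Slz) (ah l).2.
    - by rewrite Fz Fx.
  move=> y; have [[k jk Sk]|[Fy _]] := Fcase j y; last by exists y.
  have [[h' _ h'h] _] := ah k; exists (h' y).
  by rewrite (FS j k)// -hS h'h.
exists t, (F 0%N), (F 1%N); split=> //.
- by split; apply: FN.
- move=> v /=; have [[k k1 Sk]|[-> N]] := Fcase 1%N v.
    rewrite !(FS _ k)// gfix//; apply/negP => S0.
    apply: (disj' 0%N k (h k v)) => //; last by rewrite hS.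
    by case: k k1 {Sk S0}.
  have [S0|S0] := boolP (S 0%N v); first by rewrite (FS _ 0%N).
  by rewrite gfix//; apply: FN => -[//|k] _; exact: N.
- move=> v /=; have S1 k : S k.+1 (t v) = S k v by rewrite /S iterSr ts.
  have [[k _ Sk]|[-> N]] := Fcase 0%N v.
    rewrite (FS 0%N k)// (FS 1%N k.+1) ?S1//.
    by rewrite /h /= -/(iter k.+1 s _) iterSr ts.
  by rewrite FN// => -[//|k] _; rewrite S1 N.
Qed.

(** The points form an H: m3 and m2 see each other with color j, a1 and a3 hang at m3 in colors i
    and k, and b and a2 hang at m2 in colors i and k. *)
Lemma configuration i j k : i != j -> j != k -> i != k ->
  exists a1 b a2 a3 m2 m3, exists p k2 k3 : I, exists f2 f3,
  [/\ tree_aut f2 /\ tree_aut f3, f2 a1 = b /\ f3 a1 = b,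
     [/\ forall v, e a2 v != Some k2 -> f2 v = v,
        forall v, e a3 v != Some k3 -> f3 v = v &
        forall v, e a1 v != Some p -> f2 v = f3 v],
     [/\ e m3 a1 = Some i, e m3 b = Some j & e m3 a3 = Some k] &
     [/\ e m2 a1 = Some j, e m2 b = Some i & e m2 a2 = Some k]].
Proof.
move=> ij jk ik.
have sp z z' x p q : e z x = Some p -> e z z' = Some q -> p != q -> e z' x = e z' z.
  move=> zx zz' pq; apply: (kt_sep K); first by rewrite eq_sym; exact: e_neq zz'.
  by rewrite zx zz'; apply: contraNneq pq => -[->].
have ji := ij; have kj := jk; have ki := ik.
rewrite eq_sym in ji; rewrite eq_sym in kj; rewrite eq_sym in ki.
have [m3] : exists m3 : B, True by have [u _] := kt_enum K; exists (u 0%N).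
move=> _; have [m2 [m32 m23]] := leaf_exists m3 j j.
have [a1 [m3a1 a1m3]] := leaf_exists m3 i i.
have [b [m2b bm2]] := leaf_exists m2 i i.
have [a3 m3a3] := kt_dir K m3 k; have [a2 m2a2] := kt_dir K m2 k.
have ne := e_neq.
have m32n := ne _ _ _ m23; have m23n := ne _ _ _ m32.
have n31 : m3 != a1 by rewrite eq_sym; apply: ne m3a1.
have n33 : m3 != a3 by rewrite eq_sym; apply: ne m3a3.
have n2b : m2 != b by rewrite eq_sym; apply: ne m2b.
have n22 : m2 != a2 by rewrite eq_sym; apply: ne m2a2.
have m3b : e m3 b = Some j by rewrite -m32; exact: sp m2b m23 ij.
have m3a2 : e m3 a2 = Some j.
  by rewrite -m32; exact: sp m2a2 m23 kj.
have m2a1 : e m2 a1 = Some j.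
  by rewrite -m23; exact: sp m3a1 m32 ij.
have m2a3 : e m2 a3 = Some j.
  by rewrite -m23; exact: sp m3a3 m32 kj.
have a3a1 : e a3 a1 = e a3 m3 by exact: sp m3a1 m3a3 ik.
have a3b : e a3 b = e a3 m3 by exact: sp m3b m3a3 jk.
have a2a1 : e a2 a1 = e a2 m2 by exact: sp m2a1 m2a2 jk.
have a2b : e a2 b = e a2 m2 by exact: sp m2b m2a2 ik.
have a1a3 : e a1 a3 = Some i by rewrite -a1m3; exact: sp m3a3 m3a1 ki.
have a1a2 : e a1 a2 = Some i by rewrite -a1m3; exact: sp m3a2 m3a1 ji.
have ba2 : e b a2 = Some i by rewrite -bm2; exact: sp m2a2 m2b ki.
have ba3 : e b a3 = Some i by rewrite -bm2; exact: sp m2a3 m2b ji.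
have [k3 a3m3] := e_some n33; have [k2 a2m2] := e_some n22.
rewrite a3m3 in a3a1 a3b; rewrite a2m2 in a2a1 a2b.
(* The mutual colors of a3 with a1 and with b agree, so a3 can be fixed while a1 moves to b;
   likewise for a2. *)
have [F3 [F3a F3a3 F3a1]] := aut_pair (etrans a3a1 (esym a3b)) (etrans a1a3 (esym ba3)).
have [F2 [F2a F2a2 F2a1]] := aut_pair (etrans a2a1 (esym a2b)) (etrans a1a2 (esym ba2)).
pose f3 v := if e a3 v == Some k3 then F3 v else v.
pose f2' v := if e a2 v == Some k2 then F2 v else v.
(* Outside color i at a1 this copies f3. All such points lie in color k2 at a2, because a2 has color
   i at a1, so the support stays in that half-tree at a2. *)
pose f2 v := if e a1 v == Some i then f2' v else f3 v.
have af3 : tree_aut f3 by apply: aut_glue => //; exact: aut_id.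
have af2' : tree_aut f2' by apply: aut_glue => //; exact: aut_id.
have f3a1 : f3 a1 = b by rewrite /f3 a3a1 eqxx.
have f2'a1 : f2' a1 = b by rewrite /f2' a2a1 eqxx.
exists a1, b, a2, a3, m2, m3, i, k2, k3, f2, f3; split=> //.
- by split=> //; apply: aut_glue => //; rewrite f3a1.
- by split=> //; rewrite /f2 e_self.
- split=> v vN; last by rewrite /f2 (negbTE vN).
    rewrite /f2; case: ifPn => v1; first by rewrite /f2' (negbTE vN).
    case/negP: vN; rewrite -a2a1; apply/eqP/(kt_sep K); last by rewrite a1a2.
    exact: ne a2a1.
  by rewrite /f3 (negbTE vN).
Qed.

End Tree.

(** * Pairing an invariant cocycle with the bar complex *)

Lemma freeg_morph0 (T : choiceType) (V : zmodType) (f : {freeg T / int} -> V) :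
  {morph f : x y / x - y} -> (forall k, f << k >> = 0) -> forall D, f D = 0.
Proof.
move=> fB f1 D; pose F : {additive {freeg T / int} -> V} :=
  HB.pack f (GRing.isZmodMorphism.Build _ _ f fB).
rewrite -[f D]/(F D) -(freeg_sumE D) raddf_sum big1// => z _.
by rewrite -(intz (coeff z D)) -freegU_mulz raddfMz [F _]f1 mul0rz.
Qed.

Lemma freeg_morphD (T : choiceType) (V : zmodType) (f : {freeg T / int} -> V) :
  {morph f : x y / x - y} -> {morph f : x y / x + y}.
Proof.
move=> fB x y.
have f0 : f 0 = 0 by have := fB 0 0; rewrite !subrr.
by rewrite -[y in LHS]opprK fB -[- y]sub0r fB f0 sub0r opprK.
Qed.

Section Pairing.
Variables (G : groupType) (B : choiceType) (act : G -> B -> B).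
Variable omega : B -> B -> B -> int.
Hypothesis actM : forall g h x, act (g * h)%g x = act g (act h x).
Hypothesis omegaG : forall g x y w,
  omega (act g x) (act g y) (act g w) = omega x y w.
Hypothesis omega_cocycle : forall x y w v,
  omega y w v - omega x w v + omega x y v - omega x y w = 0.

Definition pairing (x : B) : {freeg (G * G)%type / int} -> int :=
  fglift (fun u : G * G => omega x (act u.1 x) (act (u.1 * u.2)%g x) : int^o).

Lemma pairingB x : {morph pairing x : w v / w - v}.
Proof. exact: (@lift_is_additive _ _ int^o). Qed.

Lemma pairingD x : {morph pairing x : w v / w + v}.
Proof. exact: freeg_morphD (pairingB x). Qed.

Lemma pairingU x u :
  pairing x << u >> = omega x (act u.1 x) (act (u.1 * u.2)%g x).
Proof. by rewrite /pairing liftU scale1r. Qed.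

Lemma bar_d2B : {morph @bar_d2 G : x y / x - y}.
Proof. exact: lift_is_additive. Qed.

Lemma bar_d2D : {morph @bar_d2 G : x y / x + y}.
Proof. exact: freeg_morphD bar_d2B. Qed.

(** On a generator [g|h|k] this is the cocycle identity at x, gx, ghx, ghkx, after translating the
    face based at x by g. *)
Lemma pairing_boundary x w : pairing x (bar_d3 w) = 0.
Proof.
have d3B : {morph @bar_d3 G : x y / x - y} by exact: lift_is_additive.
apply: (@freeg_morph0 _ _ (fun w => pairing x (bar_d3 w))).
  by move=> a b /=; rewrite d3B pairingB.
move=> [[g h] k]; rewrite /bar_d3 liftU scale1r /=.
rewrite pairingB pairingD pairingB !pairingU /= !actM.
by rewrite -(omegaG g x) -[RHS](omega_cocycle x (act g x) (act g (act h x))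
   (act g (act h (act k x)))).
Qed.

(** A 2-chain is remembered only through its boundary s and its value r. The aim is s = 0 with r
    nonzero: a 2-cycle detected by omega. *)
Definition relation_value (x : B) (s : {freeg G / int}) (r : int) : Prop :=
  exists2 w, bar_d2 w = s & pairing x w = r.

Lemma relation_valueB x s r s' r' : relation_value x s r ->
  relation_value x s' r' -> relation_value x (s - s') (r - r').
Proof.
by move=> [w <- <-] [w' <- <-]; exists (w - w'); rewrite ?bar_d2B ?pairingB.
Qed.

Lemma relation_valueD x s r s' r' : relation_value x s r ->
  relation_value x s' r' -> relation_value x (s + s') (r + r').
Proof.
by move=> [w <- <-] [w' <- <-]; exists (w + w'); rewrite ?bar_d2D ?pairingD.
Qed.

Lemma relation_value_mul x g h :
  relation_value x (<< h >> - << (g * h)%g >> + << g >>)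
    (omega x (act g x) (act g (act h x))).
Proof.
by exists << (g, h) >>; rewrite ?pairingU ?actM// /bar_d2 liftU scale1r.
Qed.

(* The cocycles based at x and y differ by the coboundary of psi. *)
Lemma relation_value_base x y g r : relation_value y << g >> r ->
  relation_value x << g >> (r + omega x (act g x) (act g y) - omega x y (act g y)).
Proof.
pose psi g : int := omega x (act g x) (act g y) - omega x y (act g y).
pose Psi : {freeg G / int} -> int := fglift (psi : G -> int^o).
have PsiB : {morph Psi : a b / a - b} by exact: (@lift_is_additive _ _ int^o).
have PsiD := freeg_morphD PsiB.
have E w : pairing x w - pairing y w - Psi (bar_d2 w) = 0.
  move: w; apply: (@freeg_morph0 _ _
    (fun w => pairing x w - pairing y w - Psi (bar_d2 w))).
    by move=> a b /=; rewrite bar_d2B PsiB !pairingB; lia.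
  move=> [h k]; rewrite !pairingU /bar_d2 liftU scale1r /= PsiD PsiB.
  rewrite /Psi !liftU !scale1r /psi !actM.
  (* The three cocycle identities triangulate the prism between the triangles x, hx, hkx and y, hy,
     hky; invariance under h treats its translated side face. *)
  have := omega_cocycle x (act h x) (act h (act k x)) (act h (act k y)).
  have := omega_cocycle x (act h x) (act h y) (act h (act k y)).
  have := omega_cocycle x y (act h y) (act h (act k y)).
  have := omegaG h x (act k x) (act k y).
  have := omegaG h x y (act k y).
  lia.
case=> w d2w pw; exists w => //; have := E w.
by rewrite d2w pw /Psi liftU scale1r /psi; lia.
Qed.

(** The pairing kills boundaries, so if k times the cycle bounds then k r = 0. *)
Lemma relation_value_nontorsion x r : relation_value x 0 r -> r != 0 ->
  ~ torsion_group (H2 G).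
Proof.
case=> w d2w pw r0 tors.
have wc : w \in @cycle2_pred G by rewrite unfold_in d2w.
pose z : cycle2 G := exist _ w wc.
have [k k0 kz] := tors (\pi_(H2 G)%qT z).
have : z *+ k - 0 \in @boundary2 G.
  rewrite Quotient.idealrBE; apply/eqP.
  by rewrite raddfMn raddf0.
rewrite subr0 => /asboolP[v hv].
have := pairing_boundary x v; rewrite hv raddfMn /=.
have -> : pairing x (w *+ k) = pairing x w *+ k.
  elim: {k0 kz hv} k => [|k IH]; first by have := pairingB x 0 0; rewrite !subrr.
  by rewrite !mulrS pairingD IH.
by rewrite pw => /eqP; rewrite mulrn_eq0 (negbTE r0) orbF; case: k k0 {kz hv}.
Qed.

End Pairing.

(** * The median cocycle of an antisymmetric kernel on colors *)

Section MedianCocycle.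
Variables (B : choiceType) (I : eqType) (e : B -> B -> option I).
Hypothesis K : kaleidoscopic_tree e.
Variable alpha : I -> I -> int.
Hypothesis alphaN : forall i j, alpha i j = - alpha j i.

(** A median may be one of the three points and sees itself as [None]; the value 0 there preserves
    antisymmetry. *)
Definition alpha_opt (p q : option I) : int :=
  if p is Some i then if q is Some j then alpha i j else 0 else 0.

Lemma alpha_optN p q : alpha_opt p q = - alpha_opt q p.
Proof. by case: p q => [i|] [j|] //=; rewrite oppr0. Qed.

Definition local_cocycle (m x y w : B) : int :=
  alpha_opt (e m x) (e m y) + alpha_opt (e m y) (e m w)
  + alpha_opt (e m w) (e m x).

Definition is_median (m x y w : B) : bool :=
  [&& e m x != e m y, e m y != e m w & e m x != e m w].

(** At least two of the three points lie, at m, off the direction of m'; those two then have the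
    same color at m'. *)
Lemma is_median_uniq m m' x y w :
  is_median m x y w -> is_median m' x y w -> m = m'.
Proof.
move=> /and3P[xy yw xw] /and3P[xy' yw' xw']; apply/eqP/negP => /negP mm'.
have sep := @kt_sep _ _ _ K m m' _ mm'.
have [Ex|Nx] := eqVneq (e m x) (e m m').
  move/eqP: yw'; apply; rewrite !sep// -Ex; first by rewrite eq_sym.
  by rewrite eq_sym.
have [Ey|Ny] := eqVneq (e m y) (e m m').
  by move/eqP: xw'; apply; rewrite !sep// -Ey eq_sym.
by move/eqP: xy'; apply; rewrite !sep.
Qed.

Lemma local_cocycle0 m x y w : ~~ is_median m x y w -> local_cocycle m x y w = 0.
Proof.
have a0 p : alpha_opt p p = 0 by have := alpha_optN p p; lia.
rewrite !negb_and !negbK /local_cocycle => /or3P[]/eqP ->; rewrite a0.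
- by rewrite (alpha_optN (e m w)); lia.
- by rewrite (alpha_optN (e m x)); lia.
- by rewrite (alpha_optN (e m w)); lia.
Qed.

Definition median_cocycle (x y w : B) : int :=
  if pselect (exists m, is_median m x y w) is left E
  then local_cocycle (sval (cid E)) x y w else 0.

Lemma median_cocycleE m x y w : is_median m x y w ->
  median_cocycle x y w = local_cocycle m x y w.
Proof.
move=> mm; rewrite /median_cocycle; case: pselect => [E|]; last by case; exists m.
by case: (cid E) => m' /= /is_median_uniq /(_ mm) ->.
Qed.

Lemma median_cocycle0 x y w : (forall m, ~~ is_median m x y w) ->
  median_cocycle x y w = 0.
Proof.
move=> N; rewrite /median_cocycle; case: pselect => // E.
by case: (cid E) => m /= mm; have := N m; rewrite mm.
Qed.

Lemma median_cocycle_eq01 x y : median_cocycle x x y = 0.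
Proof. by apply: median_cocycle0 => m; rewrite /is_median eqxx. Qed.

Lemma median_cocycle_eq12 x y : median_cocycle x y y = 0.
Proof. by apply: median_cocycle0 => m; rewrite /is_median eqxx andbF. Qed.

(** Local terms vanish away from the median, so any finite set containing it can serve as index set.
    The four terms of the cocycle identity can thus be summed over a common set. *)
Lemma median_cocycle_sum s x y w : uniq s ->
  (forall m, is_median m x y w -> m \in s) ->
  median_cocycle x y w = \sum_(m <- s) local_cocycle m x y w.
Proof.
move=> us H; have [[m mm]|N] := pselect (exists m, is_median m x y w).
  rewrite (median_cocycleE mm) (bigD1_seq m) ?H//= big1 ?addr0// => m' m'm.
  apply: local_cocycle0; apply: contra_neqN m'm => mm'.
  exact: is_median_uniq mm' mm.
rewrite median_cocycle0 ?big1// => m; last first.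
  by apply/negP => mm; apply: N; exists m.
by move=> _; apply: local_cocycle0; apply/negP => mm; apply: N; exists m.
Qed.

Lemma median_cover x y w : exists s : seq B, forall m, is_median m x y w -> m \in s.
Proof.
have [[m mm]|N] := pselect (exists m, is_median m x y w).
  by exists [:: m] => m' /is_median_uniq /(_ mm) ->; rewrite inE.
by exists [::] => m mm; case: N; exists m.
Qed.

Lemma median_cocycle_closed x y w v :
  median_cocycle y w v - median_cocycle x w v
  + median_cocycle x y v - median_cocycle x y w = 0.
Proof.
have [s1 h1] := median_cover y w v; have [s2 h2] := median_cover x w v.
have [s3 h3] := median_cover x y v; have [s4 h4] := median_cover x y w.
pose s := undup (s1 ++ s2 ++ s3 ++ s4).
have us : uniq s by exact: undup_uniq.
rewrite !(median_cocycle_sum us) => [||||]; first last.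
- by move=> m /h1; rewrite mem_undup !mem_cat => ->.
- by move=> m /h2; rewrite mem_undup !mem_cat => ->; rewrite !orbT.
- by move=> m /h3; rewrite mem_undup !mem_cat => ->; rewrite !orbT.
- by move=> m /h4; rewrite mem_undup !mem_cat => ->; rewrite !orbT.
(* For fixed m the local term is the coboundary of the antisymmetric kernel sending x, y to
   [alpha_opt (e m x) (e m y)], hence closed. *)
rewrite -sumrB -big_split/= -sumrB big1// => m _; rewrite /local_cocycle.
have := alpha_optN (e m w) (e m y); have := alpha_optN (e m v) (e m y).
have := alpha_optN (e m w) (e m x); have := alpha_optN (e m v) (e m x).
lia.
Qed.

End MedianCocycle.

(** * Half-tree relations and a 2-cycle of nonzero value *)

Section NonTorsion.
Variables (B : choiceType) (I : eqType) (e : B -> B -> option I).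
Hypothesis K : kaleidoscopic_tree e.
Variable alpha : I -> I -> int.
Hypothesis alphaN : forall i j, alpha i j = - alpha j i.
Variables (G : groupType) (act : G -> B -> B).
Hypothesis actM : forall g h x, act (g * h)%g x = act g (act h x).
Hypothesis act_inj : forall g h, act g =1 act h -> g = h.
Hypothesis act_aut : forall f, tree_aut e f -> exists g, act g =1 f.
Hypothesis act_color : forall g z, exists gamma : I -> I,
  [/\ injective gamma, forall i j, alpha (gamma i) (gamma j) = alpha i j &
     forall x, e (act g z) (act g x) = omap gamma (e z x)].

Local Notation omega := (median_cocycle e alpha).

Lemma median_cocycle_act g x y w :
  omega (act g x) (act g y) (act g w) = omega x y w.
Proof.
(* The identity is realized by some h, and 1 acts trivially because 1 * h acts as h. *)
have act1 z : act 1%g z = z.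
  have [h hid] := act_aut (aut_id e).
  by rewrite -[in LHS](hid z) -actM mul1g hid.
have actVK z : act g (act g^-1%g z) = z by rewrite -actM mulgV.
have med m : is_median e (act g m) (act g x) (act g y) (act g w)
             = is_median e m x y w.
  have [gamma [gi _ ge]] := act_color g m.
  have oi : injective (omap gamma) by exact: inj_omap.
  by rewrite /is_median !ge !(inj_eq oi).
have [[m mm]|N] := pselect (exists m, is_median e m x y w).
  have mm' : is_median e (act g m) (act g x) (act g y) (act g w) by rewrite med.
  rewrite (median_cocycleE K _ mm) (median_cocycleE K _ mm') /local_cocycle.
  have [gamma [_ ga ge]] := act_color g m; rewrite !ge.
  by case: (e m x) (e m y) (e m w) => [i|] [j|] [k|] //=; rewrite !ga.
rewrite !median_cocycle0// => m; apply/negP => mm; apply: N; first by exists m.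
by exists (act g^-1%g m); rewrite -med actVK.
Qed.

Local Notation rval := (relation_value act omega).

(** Based at a, the relations for the products g H2, T H1 and H2 T have value 0, because g, H1 and
    H2 fix a. Their combination has boundary [g], and moving the base point from a to x leaves the
    stated value. *)
Lemma half_tree_relation x a p g f : tree_aut e f -> act g =1 f ->
  (forall v, e a v != Some p -> f v = v) ->
  rval x << g >> (omega x (act g x) a).
Proof.
move=> af gf fix_.
have [t [G1 [G2 [at_ [aG1 aG2] [G1a G2a] fG tG]]]] := swindle K af fix_.
have [T Tt] := act_aut at_; have [H1 H1E] := act_aut aG1.
have [H2 H2E] := act_aut aG2.
have ga : act g a = a by rewrite gf fix_// (e_self K).
have H1a : act H1 a = a by rewrite H1E.
have H2a : act H2 a = a by rewrite H2E.
have E1 : (g * H2)%g = H1.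
  by apply: act_inj => v; rewrite actM gf H2E H1E fG.
have E2 : (H2 * T)%g = (T * H1)%g.
  by apply: act_inj => v; rewrite !actM H2E !Tt H1E; have := tG v => /= ->.
have R1 := relation_value_mul omega actM a g H2.
have R2 := relation_value_mul omega actM a T H1.
have R3 := relation_value_mul omega actM a H2 T.
rewrite E1 H2a ga median_cocycle_eq01 in R1.
rewrite H1a median_cocycle_eq12 in R2.
rewrite E2 H2a median_cocycle_eq01 in R3.
have := relation_valueB (relation_valueD R1 R2) R3.
rewrite addr0 subr0 (_ : _ - _ = << g >>); last first.
  by apply/eqP/freeg_eqP => v; rewrite !(coeffB, coeffD); ring.
move=> /(relation_value_base actM median_cocycle_act
  (median_cocycle_closed K alphaN) x).
by rewrite ga median_cocycle_eq12 subr0 add0r.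
Qed.

Theorem median_cocycle_nontorsion i j k :
  alpha i j + alpha j k + alpha k i != 0 -> ~ torsion_group (H2 G).
Proof.
move=> d0; have a0 l : alpha l l = 0 by have := alphaN l l; lia.
have ij : i != j.
  by apply: contraNneq d0 => ->; rewrite a0 (alphaN k); apply/eqP; lia.
have jk : j != k.
  by apply: contraNneq d0 => ->; rewrite a0 (alphaN i); apply/eqP; lia.
have ik : i != k.
  by apply: contraNneq d0 => ->; rewrite a0 (alphaN j); apply/eqP; lia.
have [a1 [b [a2 [a3 [m2 [m3 [p [k2 [k3 [f2 [f3]]]]]]]]]]] := configuration K ij jk ik.
move=> [[af2 af3] [f2a1 f3a1] [fix2 fix3 f23] [m3a1 m3b m3a3] [m2a1 m2b m2a2]].
have [[f2' f2K f2'K] _] := af2; have af2' := aut_can af2 f2K.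
have [g2 g2E] := act_aut af2; have [g3 g3E] := act_aut af3.
have ah : tree_aut e (f2' \o f3) by exact: aut_comp.
have [h hE] := act_aut ah.
have fixh v : e a1 v != Some p -> (f2' \o f3) v = v.
  by move=> /f23 /= <-; rewrite f2K.
have E : (g2 * h)%g = g3.
  by apply: act_inj => v; rewrite actM g2E hE /= f2'K g3E.
have ha1 : act h a1 = a1 by rewrite hE fixh// (e_self K).
have R2 := half_tree_relation a1 af2 g2E fix2.
have R3 := half_tree_relation a1 af3 g3E fix3.
have Rh := half_tree_relation a1 ah hE fixh.
have R := relation_value_mul omega actM a1 g2 h.
rewrite E ha1 median_cocycle_eq12 in R.
rewrite ha1 median_cocycle_eq01 in Rh.
rewrite g2E f2a1 in R2; rewrite g3E f3a1 in R3.
(* The generators for h, g3 and g2 cancel, leaving boundary 0. *)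
have := relation_valueB R (relation_valueD (relation_valueB Rh R3) R2).
rewrite subrr => /(relation_value_nontorsion actM median_cocycle_act
  (median_cocycle_closed K alphaN)); apply.
have SE (x y : I) : (Some x == Some y :> option I) = (x == y) by [].
have ji : j != i by rewrite eq_sym.
have md3 : is_median e m3 a1 b a3 by rewrite /is_median m3a1 m3b m3a3 !SE ij jk.
have md2 : is_median e m2 a1 b a2 by rewrite /is_median m2a1 m2b m2a2 !SE ji ik.
rewrite (median_cocycleE K alpha md2) (median_cocycleE K alpha md3).
rewrite /local_cocycle m3a1 m3b m3a3 m2a1 m2b m2a2 /=.
have := alphaN j i; have := alphaN i k; have := alphaN k j.
by move: d0; lia.
Qed.

End NonTorsion.

(** * Invariant kernels from orbits on pairs of colors *)

Section OrientedOrbital.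
Variables (T : choiceType) (Gamma : groupClosed (SymGroup T)).

Definition same_pair_orbit (a b k l : T) : Prop :=
  exists2 g, g \in Gamma & g a = k /\ g b = l.

(** The indicator of the orbital of (a, b) minus that of its transpose; it is zero exactly when the
    orbital is symmetric. *)
Definition orbital_kernel (a b k l : T) : int :=
  `[< same_pair_orbit a b k l >]%:Z - `[< same_pair_orbit a b l k >]%:Z.

Lemma orbital_kernelN a b k l : orbital_kernel a b k l = - orbital_kernel a b l k.
Proof. by rewrite /orbital_kernel opprB. Qed.

Lemma orbital_kernel_inv a b g k l : g \in Gamma ->
  orbital_kernel a b (g k) (g l) = orbital_kernel a b k l.
Proof.
move=> gG; rewrite /orbital_kernel; have E k' l' :
    `[< same_pair_orbit a b (g k') (g l') >] = `[< same_pair_orbit a b k' l' >].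
  apply/asbool_equiv_eq; split=> -[h hG [ha hb]].
    exists (g^-1 * h)%g; first by rewrite gpredM// gpredV.
    by rewrite /= ha hb; split; exact: symK.
  by exists (g * h)%g; [rewrite gpredM|rewrite /= ha hb].
by rewrite !E.
Qed.

Lemma orbital_kernel_le1 a b k l : - 1 <= orbital_kernel a b k l <= 1.
Proof. by rewrite /orbital_kernel; do 2!case: `[< _ >]. Qed.

Lemma orbital_kernel1 a b k l : same_pair_orbit a b k l ->
  ~ same_pair_orbit a b l k -> orbital_kernel a b k l = 1.
Proof. by move=> h1 h2; rewrite /orbital_kernel asboolT// asboolF. Qed.

Lemma orbital_kernel0 a b k l : ~ same_pair_orbit a b k l ->
  ~ same_pair_orbit a b l k -> orbital_kernel a b k l = 0.
Proof. by move=> h1 h2; rewrite /orbital_kernel !asboolF. Qed.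

Lemma same_pair_orbit_refl a b : same_pair_orbit a b a b.
Proof. by exists 1%g; first exact: gpred1. Qed.

Lemma orbit_of_refl x : orbit_of Gamma x x.
Proof. by exists 1%g; first exact: gpred1. Qed.

Lemma orbit_of_eq x y : orbit_of Gamma x y -> orbit_of Gamma x = orbit_of Gamma y.
Proof.
move=> [g gG <-]; apply/seteqP; split=> z [h hG <-].
  by exists (h * g^-1)%g; [rewrite gpredM// gpredV|rewrite /= symK].
by exists (h * g)%g; first by rewrite gpredM.
Qed.

Lemma pair_orbit1 a b k l : same_pair_orbit a b k l -> orbit_of Gamma a k.
Proof. by case=> g gG [ak _]; exists g. Qed.

Lemma pair_orbit2 a b k l : same_pair_orbit a b k l -> orbit_of Gamma b l.
Proof. by case=> g gG [_ ak]; exists g. Qed.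

Lemma exists_orbital_kernel :
  ~ generously_transitive Gamma -> ~ semi_generous Gamma ->
  exists a b, exists i j k, orbital_kernel a b i j + orbital_kernel a b j k
    + orbital_kernel a b k i != 0.
Proof.
move=> ngt nsg.
(* Some orbit has a pair x, g x that cannot be exchanged: on x, g x, g (g x) two terms are 1 and the
   last is at least -1. *)
have [[x [g gG nswap]]|swap] := pselect (exists x, exists2 g, g \in Gamma &
    ~ exists2 h, h \in Gamma & h x = g x /\ h (g x) = x).
  exists x, (g x), x, (g x), (g (g x)).
  have E : orbital_kernel x (g x) x (g x) = 1.
    exact: orbital_kernel1 (same_pair_orbit_refl _ _) nswap.
  rewrite orbital_kernel_inv// E.
  by have := orbital_kernel_le1 x (g x) (g (g x)) x; lia.
(* From here on every orbit is generously transitive, so there are at least two orbits. *)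
have gen x : generously_transitive_on Gamma (orbit_of Gamma x).
  move=> y z [g gG <-] [h hG <-]; apply: contrapT => N; apply: swap.
  exists (g x), (h * g^-1)%g; first by rewrite gpredM// gpredV.
  by rewrite /= symK.
have [a [b ab]] : exists a b, ~ orbit_of Gamma a b.
  apply: contrapT => N; apply: ngt => x y _ _.
  apply: (gen x) => //; first exact: orbit_of_refl.
  by apply: contrapT => xy; apply: N; exists x, y.
(* With a third orbit, only the term of (a, b) survives on a, b, c. *)
have [[c [ac bc]]|N] := pselect (exists c, ~ orbit_of Gamma a c /\ ~ orbit_of Gamma b c).
  exists a, b, a, b, c; rewrite orbital_kernel1; last 2 first.
  - exact: same_pair_orbit_refl.
  - by move/pair_orbit1.
  rewrite !orbital_kernel0//.
  - by move/pair_orbit1.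
  - by move/pair_orbit2.
  - by move/pair_orbit2.
  - by move/pair_orbit1.
(* There remain exactly two orbits, which cannot be orthogonal. *)
have [a1 [b1 [a2 [b2 [A1 B1 A2 B2 N2]]]]] : exists a1 b1 a2 b2,
    [/\ orbit_of Gamma a a1, orbit_of Gamma b b1, orbit_of Gamma a a2,
       orbit_of Gamma b b2 & ~ same_pair_orbit a1 b1 a2 b2].
  apply: contrapT => N'; apply: nsg; exists a, b; split=> //.
  - by move=> E; apply: ab; rewrite E; exact: orbit_of_refl.
  - move=> x; apply: contrapT => /not_orP[xa xb]; apply: N; exists x.
    by split=> /orbit_of_eq E; [apply: xa|apply: xb].
  - move=> a1 b1 a2 b2 A1 B1 A2 B2; apply: contrapT => N3; apply: N'.
    by exists a1, b1, a2, b2.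
have disj x : orbit_of Gamma a x -> ~ orbit_of Gamma b x.
  move=> ax bx; apply: ab; rewrite (orbit_of_eq ax) -(orbit_of_eq bx).
  exact: orbit_of_refl.
have inA k l : same_pair_orbit a1 b1 k l -> orbit_of Gamma a k.
  by move/pair_orbit1; rewrite -(orbit_of_eq A1).
have inB k l : same_pair_orbit a1 b1 k l -> orbit_of Gamma b l.
  by move/pair_orbit2; rewrite -(orbit_of_eq B1).
have k22 : orbital_kernel a1 b1 a2 b2 = 0.
  by apply: orbital_kernel0 => // /inA; apply: contraPnot B2 => /disj.
have kAA x y : orbit_of Gamma a x -> orbit_of Gamma a y ->
    orbital_kernel a1 b1 x y = 0.
  by move=> ax ay; apply: orbital_kernel0 => /inB; apply: disj.
have kBB x y : orbit_of Gamma b x -> orbit_of Gamma b y ->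
    orbital_kernel a1 b1 x y = 0.
  by move=> bx by_; apply: orbital_kernel0 => /inA /disj.
have nBA x y : orbit_of Gamma b x -> ~ same_pair_orbit a1 b1 x y.
  by move=> bx /inA /disj.
(* The kernel vanishes inside each orbit. It is 1 at (a1, b1) and 0 at (a2, b2), so its value at
   (a1, b2) differs from one of these: this decides which triple to use. *)
have [p12|p12] := pselect (same_pair_orbit a1 b1 a1 b2).
  exists a1, b1, a1, a2, b2; rewrite kAA// k22 orbital_kernelN.
  by rewrite orbital_kernel1//; exact: nBA.
have k11 : orbital_kernel a1 b1 a1 b1 = 1.
  by apply: orbital_kernel1; [exact: same_pair_orbit_refl|exact: nBA].
have k12 : orbital_kernel a1 b1 a1 b2 = 0.
  by apply: orbital_kernel0; [|exact: nBA].
by exists a1, b1, a1, b1, b2; rewrite k11 kBB// orbital_kernelN k12.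
Qed.

End OrientedOrbital.

Local Open Scope classical_set_scope.
Local Open Scope ring_scope.

(** * Separation in dendrites *)

Section Arcs.
Variables (R : realType) (X : topologicalType).
Hypothesis hX : hausdorff_space X.
Implicit Types (f g : R -> X) (a b s t : R).

Definition simple_path f : Prop :=
  {within `[0, 1], continuous f} /\ {in `[0, 1] &, injective f}.

Lemma within_affine f (s d l u : R) : {within `[0, 1], continuous f} ->
  (forall r, r \in `[l, u] -> s + r * d \in `[0, 1]) ->
  {within `[l, u], continuous (fun r => f (s + r * d))}.
Proof.
move=> /subspace_continuousP cf lu; apply/subspace_continuousP => r rlu.
have cf' := cf (s + r * d) (lu r rlu).
have cphi : {for r, continuous (fun q : R => s + q * d)}.
  exact: cvgD (cvg_cst s) (@mulrr_continuous R d r).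
move=> W nW; rewrite /= nbhs_simpl.
apply: (@filterS _ (nbhs r) _ _ _ _ (cphi _ (cf' W nW))) => q /= H qlu.
by apply: H; exact: lu.
Qed.

Lemma affine_itv a b r : a <= b -> r \in `[0, 1] -> a + r * (b - a) \in `[a, b].
Proof. by move=> ab; rewrite !in_itv /= => /andP[r0 r1]; apply/andP; nra. Qed.

Lemma sub_itv01 a b t : 0 <= a -> b <= 1 -> t \in `[a, b] -> t \in `[0, 1].
Proof. by move=> a0 b1; rewrite !in_itv /=; lra. Qed.

Lemma simple_subpath f a b : simple_path f -> 0 <= a -> a < b -> b <= 1 ->
  simple_path (fun r => f (a + r * (b - a))).
Proof.
move=> [cf fi] a0 ab b1.
have aff r : r \in `[0, 1] -> a + r * (b - a) \in `[0, 1].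
  by move=> r01; apply: (sub_itv01 a0 b1); apply: affine_itv => //; exact: ltW.
split; first exact: within_affine.
move=> r q r01 q01 /(fi _ _ (aff _ r01) (aff _ q01)).
by move=> /addrI /mulIf; apply; rewrite subr_eq0 gt_eqF.
Qed.

Lemma path_segment_connected f a b : {within `[0, 1], continuous f} ->
  0 <= a -> b <= 1 -> connected (f @` `[a, b]).
Proof.
move=> cf a0 b1; apply: connected_continuous_connected.
  exact: segment_connected.
by apply: continuous_subspaceW cf => t /=; exact: sub_itv01.
Qed.

Lemma path_segment_compact f a b : {within `[0, 1], continuous f} ->
  0 <= a -> b <= 1 -> compact (f @` `[a, b]).
Proof.
move=> cf a0 b1; apply: continuous_compact; last exact: segment_compact.
by apply: continuous_subspaceW cf => t /=; exact: sub_itv01.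
Qed.

Lemma path_preimage_compact f a b (A : set X) : {within `[0, 1], continuous f} ->
  0 <= a -> b <= 1 -> closed A -> compact (`[a, b] `&` f @^-1` A).
Proof.
move=> cf a0 b1 cA; apply: (@subclosed_compact _ _ `[a, b]).
- rewrite closed_setSI; last exact: itv_closed.
  have cf' : {within `[a, b], continuous f}.
    by apply: continuous_subspaceW cf => t /=; exact: sub_itv01.
  by move/continuous_closedP : cf'; exact.
- exact: segment_compact.
- by move=> t [].
Qed.

Lemma arc_unique f g : ~ (exists A, simple_closed_curve R (A : set X)) ->
  simple_path f -> simple_path g -> f 0 = g 0 -> f 1 = g 1 ->
  f @` `[0, 1] `<=` g @` `[0, 1].
Proof.
move=> nscc [cf fi] [cg gi] fg0 fg1 _ [t0 t01 <-]; apply: contrapT => Nt0.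
have z01 : (0 : R) \in `[0, 1] by rewrite in_itv /= lexx ler01.
have o01 : (1 : R) \in `[0, 1] by rewrite in_itv /= lexx ler01.
move: (t01); rewrite /= in_itv /= => /andP[t00 t011].
pose A' := g @` `[0, 1].
have cA' : closed A'.
  by apply: compact_closed => //; exact: path_segment_compact.
have idc (A : set R) : {within A, continuous (@id R)}.
  by apply: continuous_subspaceT => x; exact: cvg_id.
(* By compactness there are a last time s before t0 and a first time u after t0 at which f meets the
   image of g. *)
have [s sP smax] : exists2 c, c \in `[0, t0] `&` f @^-1` A' &
    forall t, t \in `[0, t0] `&` f @^-1` A' -> t <= c.
  apply: (@compact_EVT_max _ _ id) => //; last exact: path_preimage_compact.
  exists 0; split; first by rewrite /= in_itv /= lexx.
  by exists 0; rewrite ?fg0.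
have [u uP umin] : exists2 c, c \in `[t0, 1] `&` f @^-1` A' &
    forall t, t \in `[t0, 1] `&` f @^-1` A' -> c <= t.
  apply: (@compact_EVT_min _ _ id) => //; last exact: path_preimage_compact.
  exists 1; split; first by rewrite /= in_itv /= lexx andbT.
  by exists 1; rewrite ?fg1.
move: sP; rewrite inE => -[/=]; rewrite in_itv /= => /andP[s0 st0] [s' s'01 gs'].
move: uP; rewrite inE => -[/=]; rewrite in_itv /= => /andP[t0u u1] [u' u'01 gu'].
have st : s < t0.
  rewrite lt_neqAle st0 andbT; apply/eqP => st; apply: Nt0.
  by exists s'; rewrite // gs' st.
have tu : t0 < u.
  rewrite lt_neqAle t0u andbT; apply/eqP => tu; apply: Nt0.
  by exists u'; rewrite // gu' tu.
have gap t : s < t -> t < u -> ~ A' (f t).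
  move=> st' tu' At; have [tt|tt] := leP t t0.
    have /smax : t \in `[0, t0] `&` f @^-1` A'.
      by rewrite inE; split=> //=; rewrite in_itv /=; lra.
    by rewrite leNgt st'.
  have /umin : t \in `[t0, 1] `&` f @^-1` A'.
    by rewrite inE; split=> //=; rewrite in_itv /=; lra.
  by rewrite leNgt tu'.
(* Around t0, f leaves the image of g at time s and is back at time u; closing this
   excursion by the piece of g from u' to s' yields a simple closed curve. *)
pose h r : X := if r <= 1 / 2 then f (s + r * (2 * (u - s)))
                else g (2 * u' - s' + r * (2 * (s' - u'))).
have su : s < u by exact: lt_trans tu.
have su' : s' != u'.
  apply: contraTneq su => E; rewrite -leNgt le_eqVlt; apply/orP; left.
  apply/eqP/fi; rewrite ?in_itv /=; [by lra|by lra|].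
  by rewrite -gs' -gu' E.
have h_f r : r \in `[0, 1 / 2] -> h r = f (s + r * (2 * (u - s))).
  by rewrite in_itv /= /h => /andP[_ ->].
have h_g r : r \in `[1 / 2, 1] -> h r = g (2 * u' - s' + r * (2 * (s' - u'))).
  rewrite in_itv /= /h => /andP[r1 r2]; case: ifPn => // r3.
  have -> : r = 1 / 2 by apply/eqP; rewrite eq_le r1 r3.
  rewrite (_ : s + _ = u); last by lra.
  by rewrite -gu'; congr g; lra.
have f_in r : r \in `[0, 1 / 2] -> s + r * (2 * (u - s)) \in `[s, u].
  by rewrite !in_itv /= => /andP[r1 r2]; apply/andP; nra.
have g_in r : r \in `[1 / 2, 1] -> 2 * u' - s' + r * (2 * (s' - u')) \in `[0, 1].
  move: s'01 u'01; rewrite /= !in_itv /= => /andP[a1 a2] /andP[a3 a4] /andP[r1 r2].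
  by apply/andP; nra.
have f_in01 r : r \in `[0, 1 / 2] -> s + r * (2 * (u - s)) \in `[0, 1].
  by move/f_in; apply: sub_itv01.
apply: nscc; exists (h @` `[0, 1]), h; split=> //.
- have -> : `[0, 1]%classic = `[0, 1 / 2] `|` `[1 / 2, 1] :> set R.
    apply/seteqP; split=> r /=; rewrite !in_itv /=; last by lra.
    by move=> /andP[r0 r1]; have [r2|r2] := leP r (1 / 2); [left|right]; lra.
  apply: withinU_continuous; [exact: itv_closed|exact: itv_closed| |].
    have := within_affine cf f_in01; apply: subspace_eq_continuous => r.
    by rewrite inE => /h_f E; exact: esym E.
  have := within_affine cg g_in; apply: subspace_eq_continuous => r.
  by rewrite inE => /h_g E; exact: esym E.
- rewrite h_f; last by rewrite in_itv /=; lra.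
  rewrite h_g; last by rewrite in_itv /=; lra.
  by rewrite mul0r addr0 -gs'; congr g; lra.
- have fg r q : r \in `[0, 1 / 2] -> q \in `]1 / 2, 1[ -> h r = h q -> False.
    move=> r1 q1; have q2 : q \in `[1 / 2, 1].
      by move: q1; rewrite !in_itv /=; lra.
    rewrite h_f// h_g// => E.
    (* The second half reaches g s' (k = 0) only at q = 1 and g u' (k = 1) only at q = 1/2; both are
       excluded for q. *)
    have q0 k : 2 * u' - s' + q * (2 * (s' - u')) = s' + k * (u' - s') ->
        k + 2 * q = 2.
      move=> Ek; have : (k + 2 * q - 2) * (u' - s') = 0 by lra.
      by move/eqP; rewrite mulf_eq0 !subr_eq0 [u' == _]eq_sym (negbTE su') orbF => /eqP.
    move: (q1); rewrite in_itv /= => /andP[q3 q4].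
    have := f_in _ r1; rewrite in_itv /= => /andP[e1 e2].
    have [e3|e3] := eqVneq s (s + r * (2 * (u - s))).
      rewrite -e3 -gs' in E; move/(gi _ _ s'01 (g_in _ q2)): E => E.
      by have := q0 0; rewrite mul0r addr0 -E => /(_ erefl); lra.
    have [e4|e4] := eqVneq (s + r * (2 * (u - s))) u.
      rewrite e4 -gu' in E; move/(gi _ _ u'01 (g_in _ q2)): E => E.
      by have := q0 1; rewrite -E mul1r addrC subrK => /(_ erefl); lra.
    apply: (gap (s + r * (2 * (u - s)))); rewrite ?lt_neqAle ?e3 ?e4//.
    by rewrite E; exists (2 * u' - s' + q * (2 * (s' - u'))) => //; exact: g_in.
  have split01 (r : R) : r \in `[0, 1[ -> r \in `[0, 1 / 2] \/ r \in `]1 / 2, 1[.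
    rewrite !in_itv /= => /andP[r0 r1].
    by have [r2|r2] := leP r (1 / 2); [left|right]; lra.
  have us0 : 2 * (u - s) != 0 by apply: mulf_neq0; rewrite ?pnatr_eq0// subr_eq0 gt_eqF.
  have su0 : 2 * (s' - u') != 0 by apply: mulf_neq0; rewrite ?pnatr_eq0// subr_eq0.
  move=> r q /split01[r1|r1] /split01[q1|q1] E.
  - move: E; rewrite !h_f// => /(fi _ _ (f_in01 _ r1) (f_in01 _ q1)).
    by move=> /addrI /mulIf; apply.
  - by have := fg _ _ r1 q1 E.
  - by have := fg _ _ q1 r1 (esym E).
  - have r2 : r \in `[1 / 2, 1] by move: r1; rewrite !in_itv /=; lra.
    have q2 : q \in `[1 / 2, 1] by move: q1; rewrite !in_itv /=; lra.
    move: E; rewrite !h_g// => /(gi _ _ (g_in _ r2) (g_in _ q2)).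
    by move=> /addrI /mulIf; apply.
Qed.

End Arcs.

(** * Components of the complement of a point *)

Section Components.
Variable X : topologicalType.
Hypothesis hX : hausdorff_space X.
Hypothesis conX : connected [set: X].
Hypothesis lcX : locally_connected X.
Implicit Types x y z : X.

Lemma set1_closed z : closed [set z].
Proof. exact: accessible_closed_set1 (hausdorff_accessible hX) z. Qed.

Lemma component_open z y : open (component_toward z y).
Proof.
rewrite openE => x Cx; have xz := connected_component_sub Cx.
have nz : nbhs x (~` [set z]).
  by apply: open_nbhs_nbhs; split=> //; exact/closed_openC/set1_closed.
have [V [oV Vx cV Vz]] := lcX nz.
rewrite /interior; apply: (@filterS _ (nbhs x) _ V).
  rewrite /component_toward (same_connected_component Cx).
  exact: connected_component_max.
exact: open_nbhs_nbhs.
Qed.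

Lemma component_avoid z (A : set X) x y : connected A -> A x -> A y -> ~ A z ->
  component_toward z x y.
Proof.
by move=> cA Ax Ay Az; exists A => //; split=> // t At tz; rewrite -tz in Az.
Qed.

Lemma component_neq z x y : component_toward z x y -> x <> z /\ y <> z.
Proof. by move=> [A [Ax Az _] Ay]; split; exact: Az. Qed.

Lemma component_refl z x : x <> z -> component_toward z x x.
Proof. by move=> xz; exact: connected_component_refl. Qed.

Lemma component_sym z x y : component_toward z x y -> component_toward z y x.
Proof. exact: connected_component_sym. Qed.

Lemma component_trans z x y w : component_toward z x y ->
  component_toward z y w -> component_toward z x w.
Proof. exact: connected_component_trans. Qed.

(** Components are open, so no other component contributes closure points; if z were missing too,
    the component would be clopen in the connected space. *)
Lemma component_closure z x : x <> z ->
  closure (component_toward z x) = component_toward z x `|` [set z].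
Proof.
move=> xz; pose C := component_toward z x.
have sub : closure C `<=` C `|` [set z].
  move=> p cp; have [->|pz] := pselect (p = z); [by right|left].
  have [q [Cq pq]] : C `&` component_toward z p !=set0.
    apply: cp; apply: open_nbhs_nbhs; split; first exact: component_open.
    exact: component_refl.
  exact: component_trans Cq (component_sym pq).
apply/seteqP; split=> // p [Cp|->]; first exact: subset_closure.
apply: contrapT => Nz.
have cC : closed C.
  move=> q cq; have [//|qz] := sub _ cq; rewrite /= in qz.
  by rewrite qz in cq; case: Nz.
have CT : C = setT.
  apply: conX; first by exists x; exact: component_refl.
    by exists C; [exact: component_open|rewrite setTI].
  by exists C => //; rewrite setTI.
have Cz : C z by rewrite CT.
by have := connected_component_sub Cz; apply.
Qed.

(** The closure of the component of x at z is connected, contains z and misses z'. This is the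
    source of the axiom [kt_sep]. *)
Lemma component_flip z z' x : z <> z' -> x <> z ->
  ~ component_toward z x z' -> component_toward z' x z.
Proof.
move=> zz' xz Nz'; apply: (@component_avoid z' (closure (component_toward z x))).
- exact/connected_closure/component_connected.
- by apply: subset_closure; exact: component_refl.
- by rewrite component_closure//; right.
- by rewrite component_closure// => -[//|/esym].
Qed.

End Components.

(** * Cut points on arcs, and medians *)

Section ArcSeparation.
Variables (R : realType) (X : topologicalType).
Hypothesis hX : hausdorff_space X.
Hypothesis conX : connected [set: X].
Hypothesis lcX : locally_connected X.
Hypothesis nscc : ~ exists A : set X, simple_closed_curve R A.
Hypothesis branch_arc : forall x y : X, x <> y ->
  exists2 z, open_arc R x y z & branch_point z.
Hypothesis branch_sep : forall x y : X, branch_point x -> branch_point y ->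
  x <> y -> exists z, [/\ z <> x, z <> y, branch_point z & ~ component_toward z x y].
Implicit Types (x y z : X) (f g : R -> X) (s t u a b : R).

Lemma zero_in01 : (0 : R) \in `[0, 1].
Proof. by rewrite in_itv /= lexx ler01. Qed.

Lemma one_in01 : (1 : R) \in `[0, 1].
Proof. by rewrite in_itv /= lexx ler01. Qed.

Lemma arc_exists x y : x <> y ->
  exists f, [/\ simple_path f, f 0 = x & f 1 = y].
Proof. by move=> /branch_arc[z [_ _ [A [f [? ? ? ? _]] _]] _]; exists f. Qed.

(** A branch point between f a and f b is given on some arc; by uniqueness of arcs it lies on f. *)
Lemma path_branch f a b : simple_path f -> 0 <= a -> a < b -> b <= 1 ->
  exists t, [/\ a < t, t < b & branch_point (f t)].
Proof.
move=> sf a0 ab b1; have [cf fi] := sf.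
have a01 : a \in `[0, 1] by rewrite in_itv /=; lra.
have b01 : b \in `[0, 1] by rewrite in_itv /=; lra.
have fab : f a <> f b by move=> /(fi _ _ a01 b01) E; rewrite E ltxx in ab.
have [z [za zb [A [g [cg gi g0 g1 gA]] Az]] bz] := branch_arc fab.
have sf' := simple_subpath sf a0 ab b1.
have /(_ z) : A `<=` (fun r => f (a + r * (b - a))) @` `[0, 1].
  rewrite -gA; apply: (arc_unique hX nscc) => //.
    by rewrite g0 mul0r addr0.
  by rewrite g1 mul1r addrC subrK.
move=> /(_ Az)[r r01 zE]; have := affine_itv (ltW ab) r01; rewrite in_itv /=.
move=> /andP[ar rb]; exists (a + r * (b - a)); rewrite zE; split=> //.
- by rewrite lt_neqAle ar andbT; apply/eqP => E; apply: za; rewrite -zE -E.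
- by rewrite lt_neqAle rb andbT; apply/eqP => E; apply: zb; rewrite -zE E.
Qed.

Definition cuts f t : Prop := forall s u, 0 <= s -> s < t -> t < u -> u <= 1 ->
  ~ component_toward (f t) (f s) (f u).

Lemma path_component f t a b : simple_path f -> 0 <= a -> b <= 1 ->
  t \in `[0, 1] -> (t < a) || (b < t) ->
  forall s u, s \in `[a, b] -> u \in `[a, b] -> component_toward (f t) (f s) (f u).
Proof.
move=> [cf fi] a0 b1 t01 out s u sab uab.
apply: (@component_avoid _ _ (f @` `[a, b])).
- exact: path_segment_connected.
- by exists s.
- by exists u.
- move=> [r rab /(fi _ _ (sub_itv01 a0 b1 rab) t01) rt].
  by move: rab; rewrite /= in_itv /= rt => /andP[]; case/orP: out; lra.
Qed.

Lemma cuts_from f t s0 u0 : simple_path f -> 0 <= s0 -> s0 < t -> t < u0 ->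
  u0 <= 1 -> ~ component_toward (f t) (f s0) (f u0) -> cuts f t.
Proof.
move=> sf s0p s0t tu0 u01 N s u s_0 st tu u1 C; apply: N.
have t01 : t \in `[0, 1] by rewrite in_itv /=; lra.
have m1 : Num.max s s0 < t by rewrite gt_max st.
have m2 : t < Num.min u u0 by rewrite lt_min tu.
have [m3 m4] : s <= Num.max s s0 /\ s0 <= Num.max s s0.
  by rewrite !le_max !lexx orbT.
have [m5 m6] : Num.min u u0 <= u /\ Num.min u u0 <= u0.
  by rewrite !ge_min !lexx orbT.
apply: (@component_trans _ _ _ (f s)).
  apply: (@path_component _ _ 0 (Num.max s s0) sf); rewrite ?in_itv /= ?m1 ?orbT//; lra.
apply: component_trans C _.
apply: (@path_component _ _ (Num.min u u0) 1 sf); rewrite ?in_itv /= ?m2//; lra.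
Qed.

(** Two branch points of the segment are separated by a third one, which the connected piece of path
    between them must contain. *)
Lemma path_cut f a b : simple_path f -> 0 <= a -> a < b -> b <= 1 ->
  exists t, [/\ a < t, t < b, branch_point (f t) & cuts f t].
Proof.
move=> sf a0 ab b1; have [cf fi] := sf.
have [t1 [at1 t1b br1]] := path_branch sf a0 ab b1.
have [t2 [t12 t2b br2]] := path_branch sf (ltW (le_lt_trans a0 at1)) t1b b1.
have i1 : t1 \in `[0, 1] by rewrite in_itv /=; lra.
have i2 : t2 \in `[0, 1] by rewrite in_itv /=; lra.
have ne : f t1 <> f t2 by move=> /(fi _ _ i1 i2) E; rewrite E ltxx in t12.
have [z [z1 z2 bz N]] := branch_sep br1 br2 ne.
have [[t tI tz]|Nz] := pselect ((f @` `[t1, t2]) z); last first.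
  case: N; apply: (@component_avoid _ _ (f @` `[t1, t2])) => //.
  - by apply: path_segment_connected => //; lra.
  - by exists t1 => //; rewrite /= in_itv /= lexx ltW.
  - by exists t2 => //; rewrite /= in_itv /= lexx ltW.
move: tI; rewrite /= in_itv /= => /andP[t1t tt2].
have t1t' : t1 < t.
  by rewrite lt_neqAle t1t andbT; apply/eqP => E; apply: z1; rewrite -tz E.
have tt2' : t < t2.
  by rewrite lt_neqAle tt2 andbT; apply/eqP => E; apply: z2; rewrite -tz E.
exists t; rewrite tz; split; [lra|lra|by []|].
by apply: (@cuts_from _ _ t1 t2) => //; rewrite ?tz//; lra.
Qed.

Lemma path_cuts f t : simple_path f -> 0 < t -> t < 1 -> cuts f t.
Proof.
move=> sf t0 t1; have [cf fi] := sf; set m := f t.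
have t01 : t \in `[0, 1] by rewrite in_itv /=; lra.
apply: (@cuts_from _ _ 0 1) => //; rewrite -/m => Dy.
pose D := component_toward m (f 0).
have [f0m f1m] := component_neq Dy.
have Dx : D (f 0) by exact: component_refl.
pose below (w : R) := [/\ 0 < w, w < t & cuts f w].
(* The cut points f w accumulate at m = f t, which is not in D; this makes D1
   clopen in D, though it contains f 0 and not f 1. *)
pose D1 := \bigcup_(w in [set w | below w]) component_toward (f w) (f 0).
have cutsD w : below w -> D (f w).
  move=> [w0 wt cw]; apply: contrapT => Nw; apply: (cw 0 1) => //; first by lra.
  by apply: (component_avoid (@component_connected _ _ _) Dx Dy Nw).
have oD1 : open D1 by apply: bigcup_open => w _; exact: component_open.
have D1x : D1 (f 0).
  have [w [w0 wt _ cw]] := path_cut sf (lexx 0) t0 (ltW t1).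
  have w01 : w \in `[0, 1] by rewrite in_itv /=; lra.
  exists w => //; apply: component_refl => /(fi _ _ zero_in01 w01) E.
  by rewrite -E ltxx in w0.
have oD2 q : D q -> ~ D1 q -> nbhs q (~` D1).
  move=> Dq Nq; have qm : q != m by apply/eqP; have [] := component_neq Dq.
  have := hX; rewrite open_hausdorff => /(_ _ _ qm)[[U V] /= [Uq Vm] [oU oV /eqP UV]].
  rewrite !inE in Uq Vm.
  have [N [oN Nq' cN NU]] := lcX (open_nbhs_nbhs (conj oU Uq)).
  apply: (@filterS _ (nbhs q) _ N); last exact: open_nbhs_nbhs.
  (* Choose a cut time w' between w and t with f w' close to m, hence outside N. At f w' the points
     f 0, f w, r and q all lie on one side, which would put q in D1. *)
  move=> r Nr [w [w0 wt cw] Cr].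
  move/subspace_continuousP : cf => /(_ t t01 V).
  move=> /(_ (open_nbhs_nbhs (conj oV Vm))) /nbhs_ballP[e /= e0 He].
  have at_ : Num.max w (t - e) < t by rewrite gt_max wt /= gtrBl.
  have a0 : 0 <= Num.max w (t - e) by rewrite le_max (ltW w0).
  have [w' [aw' w't _ cw']] := path_cut sf a0 at_ (ltW t1).
  move: aw'; rewrite gt_max => /andP[ww' ew'].
  have Vw' : V (f w').
    apply: He; last by rewrite /= in_itv /=; lra.
    by rewrite /ball /= ger0_norm; lra.
  have Nw' : ~ N (f w').
    by move=> /NU Uw'; have : (U `&` V) (f w') by []; rewrite UV.
  apply: Nq; exists w'; first by split=> //; lra.
  have w'01 : w' \in `[0, 1] by rewrite in_itv /=; lra.
  have w01 : w \in `[0, 1] by rewrite in_itv /=; lra.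
  apply: (@component_trans _ _ _ (f w)).
    apply: (@path_component _ _ 0 w sf); rewrite ?in_itv /=; lra.
  apply: (@component_trans _ _ _ r); last exact: component_avoid Nw'.
  apply: component_sym; apply: component_flip => //.
  - by move=> /(fi _ _ w01 w'01) E; rewrite E ltxx in ww'.
  - by have [] := component_neq Cr.
  - move=> rw'; apply: (cw 0 w') => //; first by lra.
    exact: component_trans Cr rw'.
have D2 : D `&` D1 = D.
  apply: component_connected; first by exists (f 0).
    by exists D1.
  exists (~` (D `\` D1)).
    apply: open_closedC; rewrite openE => q [Dq Nq].
    apply: filterI; last exact: oD2.
    by apply: open_nbhs_nbhs; split=> //; exact: component_open.
  apply/seteqP; split=> q [Dq D1q]; split=> //; first by case.
  by apply: contrapT => Nq; apply: D1q.
have : (D `&` D1) (f 1) by rewrite D2.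
move=> [_ [w [w0 wt cw] Cw]]; apply: (cw 0 1) => //; first by lra.
Qed.

Lemma branch_separates x y : x <> y ->
  exists z, [/\ z <> x, z <> y, branch_point z & ~ component_toward z x y].
Proof.
move=> /arc_exists[f [sf <- <-]].
have [t [t0 t1 bt ct]] := path_cut sf (lexx _) ltr01 (lexx _).
have t01 : t \in `[0, 1] by rewrite in_itv /=; lra.
have [_ fi] := sf; exists (f t); split=> //.
- by move=> /(fi _ _ t01 zero_in01) E; rewrite E ltxx in t0.
- by move=> /(fi _ _ t01 one_in01) E; rewrite E ltxx in t1.
- by apply: ct => //; lra.
Qed.

(** By [path_cuts] the points separating two given ones are those of their arc, up to the ends, so a
    common point of the three arcs is wanted. If there is none, the arcs P and Q cut the arc A into
    two disjoint nonempty closed sets covering it, against connectedness. *)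
Lemma median_exists x y w : x <> y -> y <> w -> x <> w ->
  exists m, [/\ ~ component_toward m x y, ~ component_toward m y w &
    ~ component_toward m x w].
Proof.
move=> xy yw xw; have [f [sf f0 f1]] := arc_exists xy.
have [cf fi] := sf.
have open_same p q : p <> q -> exists A : set X, [/\ connected A /\ closed A, A p, A q &
    forall z, component_toward z p q <-> ~ A z].
  move=> pq; have [g [sg g0 g1]] := arc_exists pq; have [cg gi] := sg.
  exists (g @` `[0, 1]); split.
  - split; first exact: path_segment_connected.
    by apply: compact_closed => //; exact: path_segment_compact.
  - by exists 0 => //; exact: zero_in01.
  - by exists 1 => //; exact: one_in01.
  - move=> z; split=> [Cz [t t01 gt]|Nz]; last first.
      apply: (component_avoid (A := g @` `[0, 1])) => //.
      + exact: path_segment_connected.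
      + by exists 0 => //; exact: zero_in01.
      + by exists 1 => //; exact: one_in01.
    have [pz qz] := component_neq Cz.
    move: (t01); rewrite /= in_itv /= => /andP[]; rewrite !le_eqVlt.
    move=> /predU1P[t0 _|t0]; first by apply: pz; rewrite -g0 -gt t0.
    move=> /predU1P[t1|t1]; first by apply: qz; rewrite -g1 -gt t1.
    apply: (path_cuts sg t0 t1 (lexx 0) t0 t1 (lexx 1)).
    by rewrite gt g0 g1.
have [A [[conA _] Ax Ay Az]] := open_same _ _ xy.
have [P [[_ cP] Py Pw Pz]] := open_same _ _ yw.
have [Q [[_ cQ] Qx Qw Qz]] := open_same _ _ xw.
have [[m [[Am Pm] Qm]]|N] := pselect (A `&` P `&` Q !=set0).
  by exists m; split; [move/Az|move/Pz|move/Qz].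
have APA : A `&` P = A.
  apply: conA; [by exists y|exists (~` Q)|by exists P] => //.
    exact: closed_openC.
  apply/seteqP; split=> p [Ap Hp]; split=> //.
    by move=> Qp; apply: N; exists p.
  apply: contrapT => /Pz Cyw; apply/Az : Ap; apply: component_trans (component_sym Cyw).
  exact/Qz.
have [_ Px] : (A `&` P) x by rewrite APA.
by case: N; exists x.
Qed.

End ArcSeparation.

(** * The kaleidoscopic group *)

Lemma metrizable_hausdorff (R : realType) (X : topologicalType) :
  metrizable R X -> hausdorff_space X.
Proof.
move=> [M [f [g [fg gf cf cg]]]] p q pq; apply: (can_inj fg).
apply: metric_hausdorff => A C nA nC.
have [r [Ar Cr]] := pq _ _ (cf _ _ nA) (cf _ _ nC).
by exists (f r).
Qed.

Lemma compact_metrizable_basis (R : realType) (X : topologicalType) :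
  compact [set: X] -> metrizable R X ->
  exists U : nat -> set X, forall (x : X) V, nbhs x V ->
    exists k, U k x /\ U k `<=` V.
Proof.
move=> cX [M [f [g [fg gf cf cg]]]].
have [[x0 _]|X0] := pselect (exists x : X, True); last first.
  by exists (fun=> set0) => x; case: X0; exists x.
pose Mp : pseudoPMetricType R := HB.pack M (isPointed.Build M (f x0)).
have cM : compact [set: Mp].
  have <- : f @` [set: X] = [set: Mp].
    by apply/seteqP; split=> // y _; exists (g y).
  by apply: continuous_compact => //; exact: continuous_subspaceT.
have [S /countable_injP[code codeI] [oS bS]] := compact_second_countable cM.
pose U k : set X := [set x | exists2 A, S A & code A = k /\ A (f x)].
exists U => x V nV.
have nfV : nbhs (f x : Mp) (g @^-1` V) by apply: cg; rewrite /= fg.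
have [A [SA Ax] AV] := bS (f x) _ nfV.
exists (code A); split; first by exists A.
move=> y [A' SA' [/codeI AA' A'y]]; rewrite -(fg y); apply: AV.
by rewrite /= -AA' ?inE.
Qed.

Section Dendrite.
Variables (R : realType) (n : option nat) (X : topologicalType).
Variable c : coloring X n.
Hypothesis n3 : at_least_three n.
Hypothesis W : wazewski_dendrite R n X.
Hypothesis Kc : kaleidoscopic R c.
Implicit Types x y z : X.

Let hX : hausdorff_space X.
Proof. by have [[[_ _ _ /metrizable_hausdorff]]] := W. Qed.
Let cptX : compact [set: X].
Proof. by have [[[]]] := W. Qed.
Let conX : connected [set: X].
Proof. by have [[[]]] := W. Qed.
Let lcX : locally_connected X.
Proof. by have [[]] := W. Qed.
Let nscc : ~ exists A : set X, simple_closed_curve R A.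
Proof. by have [[]] := W. Qed.
Let branch_arc x y : x <> y -> exists2 z, open_arc R x y z & branch_point z.
Proof. by have [_ _ _] := W; exact. Qed.

Lemma three_colors : exists i j k : initial n, [/\ i != j, j != k & i != k].
Proof.
have b0 : nat_below 0 n by move: n3; case: (n) => [[|[|[|k]]]|].
have b1 : nat_below 1 n by move: n3; case: (n) => [[|[|[|k]]]|].
have b2 : nat_below 2 n by move: n3; case: (n) => [[|[|[|k]]]|].
by exists (exist _ 0%N b0), (exist _ 1%N b1), (exist _ 2%N b2).
Qed.

Lemma component_eq z x y : x <> z ->
  component_toward z x = component_toward z y <-> component_toward z x y.
Proof.
move=> xz; split=> [E|]; last exact: same_connected_component.
by apply: component_sym; rewrite -E; exact: component_refl.
Qed.

Lemma color_toward_eq z x y : branch_point z -> x <> z -> y <> z ->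
  color_toward c z x = color_toward c z y <-> component_toward z x y.
Proof.
move=> bz xz yz; rewrite -component_eq// /color_toward; split=> [|->//].
have [_ ci _] := colorP c bz.
by apply: ci; rewrite inE; [exists x|exists y].
Qed.

Let branch_sep x y : branch_point x -> branch_point y -> x <> y ->
  exists z, [/\ z <> x, z <> y, branch_point z & ~ component_toward z x y].
Proof.
move=> bx by_ xy; have [i [j [_ [/eqP ij _ _]]]] := three_colors.
have [z [[zx zy _] bz ci cj]] := Kc bx by_ xy ij.
exists z; split=> //; move/color_toward_eq => E; apply: ij.
by rewrite -ci -cj; apply: E => //; exact: nesym.
Qed.

Lemma separating_branch x y : x <> y ->
  exists z, [/\ z <> x, z <> y, branch_point z & ~ component_toward z x y].
Proof. exact: (branch_separates hX nscc branch_arc branch_sep). Qed.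

(** A connected open neighborhood has a second point, since otherwise {x} would be clopen; a branch
    point separating two of its points lies in it. *)
Lemma branch_dense (V : set X) x : open V -> V x -> exists2 z, branch_point z & V z.
Proof.
move=> oV Vx; have [N [oN Nx cN NV]] := lcX (open_nbhs_nbhs (conj oV Vx)).
have [y Ny xy] : exists2 y, N y & x <> y.
  apply: contrapT => H.
  have NE : N = [set x].
    apply/seteqP; split=> [y Ny|_ ->//]; apply: contrapT => yx.
    by apply: H; exists y => // xy; apply: yx.
  have NT : N = setT.
    apply: conX; first by exists x.
      by exists N; rewrite ?setTI.
    by exists N; rewrite ?setTI// NE; exact: set1_closed.
  have [_ [p [q pq]] _ _] := W.
  have Np : N p by rewrite NT.
  have Nq : N q by rewrite NT.
  by rewrite NE in Np Nq; apply: pq; rewrite Np Nq.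
have [z [zx zy bz Nz]] := separating_branch xy.
exists z => //; apply: NV; apply: contrapT => nz; apply: Nz.
exact: (component_avoid cN Nx Ny nz).
Qed.

Lemma three_components_branch m x y w : ~ component_toward m x y ->
  ~ component_toward m y w -> ~ component_toward m x w ->
  m <> x -> m <> y -> m <> w -> branch_point m.
Proof.
move=> xy yw xw mx my mw.
have [xm ym wm] : [/\ x <> m, y <> m & w <> m] by split; exact: nesym.
pose f k := component_toward m (nth x [:: x; y; w] k).
have sep p q : p <> m -> ~ component_toward m p q ->
    component_toward m p <> component_toward m q by move=> pm N /component_eq - /(_ pm).
have fi : {in `I_3 &, injective f}.
  move=> [|[|[|?]]] [|[|[|?]]]; rewrite !inE//= => _ _; rewrite /f /= => E; exfalso.
  - exact: sep xm xy E.
  - exact: sep xm xw E.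
  - exact: sep xm xy (esym E).
  - exact: sep ym yw E.
  - exact: sep xm xw (esym E).
  - exact: sep ym yw (esym E).
have /card_eqPle[_ le] := inj_card_eq fi.
apply: (card_le_trans le); apply: subset_card_le => _ [k k3 <-].
exists (nth x [:: x; y; w] k) => //.
by move: k3; case: k => [|[|[|?]]].
Qed.

(** A branch point is coded by three basic open sets inside its components of colors i, j, k. If z'
    had the same code, two of these sets would miss the component of z' at z, hence lie in one
    component at z', against their different colors there. *)
Lemma branch_code : exists code : X -> nat,
  {in [set z | branch_point z] &, injective code}.
Proof.
have [[_ cX _ mX] _ _] := let: And4 D _ _ _ := W in D.
have [U HU] := compact_metrizable_basis cX mX.
have [i [j [k [ij jk ik]]]] := three_colors.
have ex z : exists s : nat * nat * nat, branch_point z ->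
    exists x y w, [/\ U s.1.1 x, U s.1.2 y & U s.2 w] /\
    [/\ forall x', U s.1.1 x' -> x' <> z /\ color_toward c z x' = i,
       forall x', U s.1.2 x' -> x' <> z /\ color_toward c z x' = j &
       forall x', U s.2 x' -> x' <> z /\ color_toward c z x' = k].
  have [bz|] := pselect (branch_point z); last by exists (0, 0, 0)%N.
  have sub l : exists r x, U r x /\
      forall x', U r x' -> x' <> z /\ color_toward c z x' = l.
    have [C [y yz <-] cy] := color_ex c l bz.
    have nC : nbhs y (component_toward z y).
      apply: open_nbhs_nbhs; split; first exact: component_open.
      exact: component_refl.
    have [r [Ury UrC]] := HU _ _ nC; exists r, y; split=> // x' /UrC yx'.
    have [_ x'z] := component_neq yx'.
    by split=> //; rewrite -cy; apply/esym/color_toward_eq.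
  have [r1 [x [xr1 r1P]]] := sub i; have [r2 [y [yr2 r2P]]] := sub j.
  by have [r3 [w [wr3 r3P]]] := sub k; exists (r1, r2, r3) => _; exists x, y, w.
have [code codeP] := choice ex.
exists (pickle \o code) => z z'; rewrite !inE /= => bz bz' /(pcan_inj pickleK) E.
have [x [y [w [[Ux Uy Uw] [Px Py Pw]]]]] := codeP z bz.
have [_ [_ [_ [_ [Px' Py' Pw']]]]] := codeP z' bz'.
rewrite -E in Px' Py' Pw'; apply: contrapT => zz'.
have [[xz cx] [yz cy] [wz cw]] := And3 (Px _ Ux) (Py _ Uy) (Pw _ Uw).
have [[xz' cx'] [yz' cy'] [wz' cw']] := And3 (Px' _ Ux) (Py' _ Uy) (Pw' _ Uw).
have flip := component_flip hX conX lcX zz'.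
have [xz'z|Nx] := pselect (component_toward z x z').
  have Ny : ~ component_toward z y z'.
    move=> yz'z; move/eqP: ij; rewrite -cx -cy; apply.
    by apply/color_toward_eq => //; exact: component_trans xz'z (component_sym yz'z).
  have Nw : ~ component_toward z w z'.
    move=> wz'z; move/eqP: ik; rewrite -cx -cw; apply.
    by apply/color_toward_eq => //; exact: component_trans xz'z (component_sym wz'z).
  move/eqP: jk; rewrite -cy' -cw'; apply; apply/color_toward_eq => //.
  exact: component_trans (flip _ yz Ny) (component_sym (flip _ wz Nw)).
have [yz'z|Ny] := pselect (component_toward z y z').
  have Nw : ~ component_toward z w z'.
    move=> wz'z; move/eqP: jk; rewrite -cy -cw; apply.
    by apply/color_toward_eq => //; exact: component_trans yz'z (component_sym wz'z).
  move/eqP: ik; rewrite -cx' -cw'; apply; apply/color_toward_eq => //.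
  exact: component_trans (flip _ xz Nx) (component_sym (flip _ wz Nw)).
move/eqP: ij; rewrite -cx' -cy'; apply; apply/color_toward_eq => //.
exact: component_trans (flip _ xz Nx) (component_sym (flip _ yz Ny)).
Qed.

(** * The tree of branch points *)

Definition branches : Type := {x : X | `[< branch_point x >]}.
HB.instance Definition _ := SubChoice.on branches.

Definition color_at (z x : X) : option (initial n) :=
  if x == z then None else Some (color_toward c z x).

Definition branch_color (z x : branches) : option (initial n) :=
  color_at (val z) (val x).

Lemma branchP (z : branches) : branch_point (val z).
Proof. by case: z => z /= /asboolP. Qed.

Lemma color_at_none z x : (color_at z x == None) = (x == z).
Proof. by rewrite /color_at; case: ifP. Qed.

Lemma color_at_self z : color_at z z = None.
Proof. by rewrite /color_at eqxx. Qed.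

Lemma color_at_some z x : x <> z -> color_at z x = Some (color_toward c z x).
Proof. by rewrite /color_at; case: eqP. Qed.

Lemma color_at_component z x y : branch_point z -> component_toward z x y ->
  color_at z x = color_at z y.
Proof.
move=> bz Cxy; have [xz yz] := component_neq Cxy.
by rewrite !color_at_some//; congr Some; apply/color_toward_eq.
Qed.

Lemma color_at_neq z x y : branch_point z -> x <> y ->
  ~ component_toward z x y -> color_at z x <> color_at z y.
Proof.
move=> bz xy N; rewrite /color_at; case: eqP => [xz|xz]; case: eqP => [yz|yz] //.
  by case: xy; rewrite xz yz.
by move=> [E]; apply: N; apply/color_toward_eq.
Qed.

Lemma branch_color_tree : kaleidoscopic_tree branch_color.
Proof.
have bp := branchP.
split.
- by move=> z x; rewrite color_at_none.
- move=> z z' x zz' /eqP Ne.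
  have zz'v : val z <> val z' by move=> /val_inj E; rewrite E eqxx in zz'.
  have [->//|/eqP xz] := eqVneq x z.
  have xzv : val x <> val z by move=> /val_inj.
  apply: color_at_component => //; apply: component_flip => // Cxz'.
  by apply: Ne; exact: color_at_component.
- move=> x y w /eqP xy /eqP yw /eqP xw.
  have xyv : val x <> val y by move=> /val_inj.
  have ywv : val y <> val w by move=> /val_inj.
  have xwv : val x <> val w by move=> /val_inj.
  have [m [mxy myw mxw]] :=
    median_exists hX conX lcX nscc branch_arc branch_sep xyv ywv xwv.
  (* The median is either one of the three branch points or has them in three different
     components. *)
  have bm : `[< branch_point m >].
    apply/asboolP; have [->//|mx] := pselect (m = val x).
    have [->//|my] := pselect (m = val y); have [->//|mw] := pselect (m = val w).
    exact: (three_components_branch mxy myw mxw).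
  exists (exist _ m bm); have := asboolW bm => bm'.
  by split; apply/eqP; apply: color_at_neq.
- move=> x y i j /eqP xy /eqP ij.
  have xyv : val x <> val y by move=> /val_inj.
  have [z [[zx zy _] bz ci cj]] := Kc (bp x) (bp y) xyv ij.
  have bz' : `[< branch_point z >] by apply/asboolP.
  exists (exist _ z bz'); rewrite /branch_color /= !color_at_some ?ci ?cj//; exact: nesym.
- move=> z i; have [C [y yz <-] cy] := color_ex c i (bp z).
  have [b bb Cb] := branch_dense (component_open hX lcX (val z) y) (component_refl yz).
  have bb' : `[< branch_point b >] by apply/asboolP.
  exists (exist _ b bb'); have [_ bz] := component_neq Cb.
  rewrite /branch_color /= -(color_at_component (bp z) Cb) color_at_some//.
  by rewrite /color_toward cy.
- exact: three_colors.
- have [code codeI] := branch_code.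
  have [_ [p [q pq]] _ _] := W.
  have [b0 [_ _ bb0 _]] := separating_branch pq.
  have bb0' : `[< branch_point b0 >] by apply/asboolP.
  (* Integers that are not codes are sent to the default branch point b0. *)
  exists (fun k => if pselect (exists b : branches, code (val b) = k) is left E
                   then sval (cid E) else exist _ b0 bb0').
  move=> b; exists (code (val b)); case: pselect => [E|]; last by case; exists b.
  case: (cid E) => b' /= E'; apply: val_inj; apply: codeI => //; rewrite inE; exact: bp.
Qed.

(** * Extension of tree automorphisms to homeomorphisms *)

Lemma color_at_inj x y : (forall z : branches, color_at (val z) x = color_at (val z) y) ->
  x = y.
Proof.
move=> H; apply: contrapT => xy; have [z [zx zy bz N]] := separating_branch xy.
have bz' : `[< branch_point z >] by apply/asboolP.
exact: (color_at_neq bz xy N) (H (exist _ z bz')).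
Qed.

(* Colors only pass to cluster points up to the junk case where the cluster point
   is the branch point itself, hence the two side conditions. *)
Lemma cluster_color (F : set_system X) (PF : ProperFilter F) (f : branches -> branches)
    x y : cluster F y ->
  (forall z : branches, x <> val z ->
     F [set y' | color_at (val (f z)) y' = color_at (val z) x]) ->
  forall z : branches, x <> val z -> y <> val (f z) ->
    color_at (val (f z)) y = color_at (val z) x.
Proof.
move=> Fy H z xz yz.
have nC : nbhs y (component_toward (val (f z)) y).
  apply: open_nbhs_nbhs; split; first exact: component_open.
  exact: component_refl.
have [y' [<- Cy']] := Fy _ _ (H z xz) nC.
exact: color_at_component (branchP _) Cy'.
Qed.

Lemma branch_extension_ex (f : branches -> branches) : tree_aut branch_color f ->
  forall x, exists y, forall z : branches, color_at (val (f z)) y = color_at (val z) x.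
Proof.
move=> [bf ef] x.
have [[z0 <-]|xB] := pselect (exists z : branches, val z = x).
  by exists (val (f z0)) => z; exact: ef.
have xz (z : branches) : x <> val z by move=> E; apply: xB; exists z.
(* The images of the branch points near x form a proper filter; by compactness it has a cluster
   point, the candidate image of x. *)
pose F := filter_from (nbhs x)
  (fun U => [set y | exists2 b : branches, U (val b) & y = val (f b)]).
have PF : ProperFilter F.
  apply: filter_from_proper.
    apply: filter_from_filter; first by exists setT; exact: filterT.
    move=> U V nU nV; exists (U `&` V); first exact: filterI.
    by move=> y [b [Ub Vb] ->]; split; exists b.
  move=> U; rewrite nbhsE => -[V [oV Vx] VU].
  have [b bb Vb] := branch_dense oV Vx.
  have bb' : `[< branch_point b >] by apply/asboolP.
  by exists (val (f (exist _ b bb'))), (exist _ b bb') => //; exact: VU.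
have [y [_ Fy]] := cptX PF filterT.
have Hy := cluster_color PF (f := f) (x := x) Fy.
have Hy' (z : branches) : y <> val (f z) -> color_at (val (f z)) y = color_at (val z) x.
  apply: Hy => // {}z _; exists (component_toward (val z) x).
    apply: open_nbhs_nbhs; split; first exact: component_open.
    exact: component_refl.
  move=> _ [b Cb ->] /=; rewrite [LHS](ef z b).
  by apply/esym/color_at_component => //; exact: branchP.
exists y => z; apply: (Hy') => yz.
(* Excluding y = f z: for w separating x from z, the color of y at f w would be both that of x and
   that of z at w. *)
have [w [wx wz bw N]] := separating_branch (xz z).
have bw' : `[< branch_point w >] by apply/asboolP.
pose w' : branches := exist _ w bw'.
have ywz : y <> val (f w').
  rewrite yz => /val_inj /(bij_inj bf) E; apply: wz.
  by rewrite E.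
apply: (color_at_neq bw (xz z) N).
by rewrite -[LHS](Hy' w' ywz) yz; exact: (ef w' z).
Qed.

Lemma branch_extension (f : branches -> branches) : tree_aut branch_color f ->
  exists F : X -> X, homeomorphism F /\
    forall (z : branches) x, color_at (val (f z)) (F x) = color_at (val z) x.
Proof.
move=> af; have [[g fg gf] ef] := af; have ag := aut_can af fg.
have [F HF] := choice (branch_extension_ex af).
have [G HG] := choice (branch_extension_ex ag).
have cont h h' H : tree_aut branch_color h -> cancel h' h ->
    (forall x (z : branches), color_at (val (h z)) (H x) = color_at (val z) x) ->
    continuous (H : X -> X).
  move=> ah h'h HH x.
  have PF : ProperFilter (H @ x) by exact: fmap_proper_filter.
  (* In a compact Hausdorff space convergence means a single cluster point; a cluster point other
     than H x would be separated from it by a branch point, where [cluster_color] forces equal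
     colors. *)
  apply: (compact_cluster_set1 hX cptX filterT PF filterT).
  have uniq y : cluster (H @ x) y -> y = H x.
    move=> Hy; apply: contrapT => yHx; have [w [wy wHx bw N]] := separating_branch yHx.
    have bw' : `[< branch_point w >] by apply/asboolP.
    pose w' : branches := exist _ w bw'.
    have w'E : val (h (h' w')) = w by rewrite h'h.
    have xw : x <> val (h' w').
      move=> E; have /eqP := HH x (h' w'); rewrite w'E -E color_at_self.
      by rewrite color_at_none => /eqP/esym.
    apply: (color_at_neq bw yHx N); rewrite -w'E HH.
    apply: (cluster_color PF Hy) => //; last by rewrite w'E; exact: nesym.
    move=> z xz; rewrite /= /nbhs /=.
    apply: (@filterS _ (nbhs x) _ (component_toward (val z) x)).
      move=> q Cq /=; rewrite HH.
      by apply/esym/color_at_component => //; exact: branchP.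
    apply: open_nbhs_nbhs; split; first exact: component_open.
    exact: component_refl.
  apply/seteqP; split=> [y /uniq //|_ ->].
  by have [y [_ Hy]] := cptX PF filterT; rewrite -(uniq y Hy).
exists F; split=> //; exists G; split.
- by move=> x; apply: color_at_inj => z; rewrite -(HF x) -{1}(fg z) HG.
- by move=> x; apply: color_at_inj => z; rewrite -(HG x) -{1}(gf z) HF.
- exact: cont af gf HF.
- exact: cont ag fg HG.
Qed.

(** * The action of the kaleidoscopic group on branch points *)

Variable Gamma : groupClosed (SymGroup (initial n)).
Local Notation KG := (kaleidoscopic_group c Gamma).

Lemma kg_homeo (g : KG) : homeomorphism (kg_sym g).
Proof. by have /asboolP[] := kg_mem g. Qed.

Lemma branch_act_subproof (g : KG) (z : branches) :
  `[< branch_point (kg_sym g (val z)) >].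
Proof. apply/asboolP/branch_image; [exact: kg_homeo|exact: branchP]. Qed.

Definition branch_act (g : KG) (z : branches) : branches :=
  exist _ (kg_sym g (val z)) (branch_act_subproof g z).

Lemma branch_actM (g h : KG) (z : branches) :
  branch_act (g * h)%g z = branch_act g (branch_act h z).
Proof. exact: val_inj. Qed.

(** Branch points are dense and the space is Hausdorff, so continuous maps agreeing on them are
    equal. *)
Lemma branch_act_inj (g h : KG) : branch_act g =1 branch_act h -> g = h.
Proof.
move=> gh; apply: val_inj; apply: sym_eqP => x; apply: contrapT => /eqP ne.
have := hX; rewrite open_hausdorff => /(_ _ _ ne)[[U V] /= [Ux Vx] [oU oV /eqP UV]].
rewrite !inE in Ux Vx.
have [_ [_ _ cg _]] := kg_homeo g; have [_ [_ _ ch _]] := kg_homeo h.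
have nU := cg _ _ (open_nbhs_nbhs (conj oU Ux)).
have nV := ch _ _ (open_nbhs_nbhs (conj oV Vx)).
have : nbhs x ((kg_sym g @^-1` U) `&` (kg_sym h @^-1` V)) by exact: filterI.
rewrite nbhsE => -[N [oN Nx] NUV]; have [b bb Nb] := branch_dense oN Nx.
have bb' : `[< branch_point b >] by apply/asboolP.
have [Ub Vb] := NUV _ Nb.
have E : kg_sym g b = kg_sym h b by have := congr1 val (gh (exist _ b bb')).
have : (U `&` V) (kg_sym g b) by split=> //; rewrite E.
by rewrite UV.
Qed.

Lemma branch_act_color (g : KG) (z : branches) : exists gamma, gamma \in Gamma /\
  forall x : branches, branch_color (branch_act g z) (branch_act g x)
            = omap gamma (branch_color z x).
Proof.
have /asboolP[hg /(_ (val z) (branchP z))[gamma gG gE]] := kg_mem g.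
exists gamma; split=> // x; rewrite /branch_color /=.
have [E|/eqP xz] := eqVneq (val x) (val z).
  by rewrite E !color_at_self.
rewrite !color_at_some//; last by move=> /(bij_inj (symP (kg_sym g))).
congr Some; rewrite gE local_actionE//; [|exact: branchP|by exists (val x)].
by rewrite component_image.
Qed.

(** The extension preserves colors, so its local actions are trivial and it belongs to the group
    whatever Gamma is. *)
Lemma branch_act_aut f : tree_aut branch_color f -> exists g : KG, branch_act g =1 f.
Proof.
move=> af; have [F [hF FE]] := branch_extension af.
have bF : `[< bijective F >].
  by apply/asboolP; case: hF => G [FG GF _ _]; exists G.
pose s : SymGroup X := MkSym bF.
have Ff (z : branches) : F (val z) = val (f z).
  by apply/eqP; rewrite -color_at_none FE color_at_none.
have sK : s \in kaleidoscopic_pred c Gamma.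
  apply/asboolP; split=> // x bx; exists 1%g; first exact: gpred1.
  move=> i; have [C [y yx <-] <-] := color_ex c i bx.
  rewrite local_actionE//; last by exists y.
  rewrite (component_image (g := s))//.
  have bx' : `[< branch_point x >] by apply/asboolP.
  have := FE (exist _ x bx') y; rewrite -Ff /= !color_at_some//.
    by move=> [E]; rewrite /= -[LHS]E.
  by move=> /(bij_inj (symP s)).
by exists (KaleidoscopicGroup sK) => z; apply: val_inj; exact: Ff.
Qed.

Theorem kaleidoscopic_H2_nontorsion :
  ~ generously_transitive Gamma -> ~ semi_generous Gamma -> ~ torsion_group (H2 KG).
Proof.
move=> ngt nsg; have [a [b [i [j [k d0]]]]] := exists_orbital_kernel ngt nsg.
apply: (median_cocycle_nontorsion branch_color_tree (orbital_kernelN Gamma a b)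
  branch_actM branch_act_inj branch_act_aut _ d0) => g z.
have [gamma [gG ge]] := branch_act_color g z; exists gamma; split=> //.
- exact: bij_inj (symP gamma).
- by move=> i' j'; exact: orbital_kernel_inv.
Qed.

End Dendrite.

Theorem corollary1p7 (R : realType) (n : option nat)
    (X : topologicalType) (c : coloring X n)
    (Gamma : groupClosed (SymGroup (initial n))) :
  at_least_three n ->
  wazewski_dendrite R n X ->
  kaleidoscopic R c ->
  ~ generously_transitive Gamma ->
  ~ semi_generous Gamma ->
  ~ trivial_group (H2 (kaleidoscopic_group c Gamma)) /\
  ~ torsion_group (H2 (kaleidoscopic_group c Gamma)).
Proof.
move=> n3 W Kc ngt nsg.
have nt := kaleidoscopic_H2_nontorsion n3 W Kc ngt nsg.
by split=> // triv; apply: nt => a; exists 1%N => //; exact: triv.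
Qed.
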